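(* Suppose the potential $q$ is continuous. If $f_2=0$ in Problem 1 (only the boundary control $f_1$ is used), then the system is not exactly controllable for any $T>0$. That is, for every $T>0$ the following fails: there is a constant $C$ such that for every $(\phi_1,\phi_2)\in\mathcal H^1_0\times\mathcal H$ there exists $f_1\in L^2(0,T)$ for which the solution $u^{(f_1,0)}$ of Problem 1 with controls $(f_1,0)$ satisfies $u^{(f_1,0)}(\cdot,T)=\phi_1$, $u_t^{(f_1,0)}(\cdot,T)=\phi_2$ and $\|f_1\|_{L^2(0,T)}\le C(\|\phi_1\|_{\mathcal H^1}+\|\phi_2\|_{\mathcal H})$.
   Context: Let $a,l>0$. The lasso graph $\Omega$ consists of a ring with one attached edge. The attached edge $e_1$ is identified with $(0,l)$: $x=l$ is the boundary vertex and $x=0$ is the interior vertex where the ring is attached. The ring, of length $2a$, is split at its midpoint (an artificial vertex) into two edges $e_2,e_3$, each identified with $(0,a)$, with $x=0$ the common interior vertex of $e_1,e_2,e_3$ and $x=a$ the midpoint of the ring. Alternatively the whole ring is one edge $e_r=(0,2a)$ starting and ending at the interior vertex: a function $\phi$ on the ring is $\phi_r(x)=\phi_2(x)$ for $0<x<a$ and $\phi_r(x)=\phi_3(2a-x)$ for $a<x<2a$. The restriction of a function $u$ to $e_j$ is $u_j$. At a vertex, $\partial u_j$ denotes the derivative of $u$ along the incident edge $e_j$ in the direction pointing outward from the vertex. The potential $q$ is real valued on $\Omega$. Spaces: $\mathcal H=L^2(\Omega)$; $\mathcal H^1=\{\phi\in\mathcal H:\ \phi_1\in H^1(e_1),\ \phi_r\in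 H^1(e_r)\}$ with $\|\phi\|_{\mathcal H^1}^2=\|\phi'\|^2_{L^2(e_1)}+\|\phi'\|^2_{L^2(e_r)}+\|\phi\|^2_{\mathcal H}$; $\mathcal H^1_0=\{\phi\in\mathcal H^1:\ \phi_1(0)=\phi_r(0)=\phi_r(2a)\}$. Problem 1, with controls $(f_1,f_2)$: $u_{tt}-u_{xx}+q(x)u=0$ for $t>0$, $x\in e_1\cup e_2\cup e_3$; $u_2(a,t)=u_3(a,t)$, $\partial u_2(a,t)+\partial u_3(a,t)=0$ for $t>0$; $u(x,0)=u_t(x,0)=0$ for $x\in\Omega$; $\partial u_1(l,t)=f_1(t)$ for $t>0$; $u_2(0,t)-u_1(0,t)=f_2(t)$, $u_3(0,t)-u_1(0,t)=0$, $\sum_{j=1}^3\partial u_j(0,t)=0$ for $t>0$. Solutions are understood in the generalized sense: let $D$ be the set of $\varphi\in\mathcal H$ with $\varphi_j,\varphi_j'$ absolutely continuous on each closed edge, $A\varphi:=-\varphi''+q\varphi\in\mathcal H$, $\varphi_1'(l)=0$, $\varphi_2(a)=\varphi_3(a)$, $\partial\varphi_2(a)+\partial\varphi_3(a)=0$, $\varphi_1(0)=\varphi_2(0)=\varphi_3(0)$, $\sum_{j=1}^3\partial\varphi_j(0)=0$. Then $u\in C([0,T];\mathcal H)$ is the solution if for every $\varphi\in D$ the function $m_\varphi(t)=\langle u(\cdot,t),\varphi\rangle_{\mathcal H}$ is in $H^2(0,T)$, $m_\varphi(0)=m_\varphi'(0)=0$, and $m_\varphi''(t)+\langle u(\cdot,t),A\varphi\rangle_{\mathcal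 H}=-f_1(t)\varphi_1(l)+f_2(t)\,\partial\varphi_2(0)$ for a.e. $t$. The equality $u_t(\cdot,T)=\psi$ with $\psi\in\mathcal H$ means $m_\varphi'(T)=\langle\psi,\varphi\rangle_{\mathcal H}$ for all $\varphi\in D$. *)

(* Defs.v *)
From mathcomp Require Import all_boot all_order all_algebra.
From mathcomp Require Import all_classical all_reals all_analysis.

Set Implicit Arguments.
Unset Strict Implicit.
Unset Printing Implicit Defensive.
Import Order.TTheory GRing.Theory Num.Theory.
Import numFieldNormedType.Exports.
Local Open Scope classical_set_scope.
Local Open Scope ring_scope.

Section OneDimension.
Context {R : realType}.
Implicit Types (L x : R) (f g : R -> R).
Notation mu := (@lebesgue_measure R).

Definition ae_on L (P : R -> Prop) : Prop :=
  {ae mu, forall x : R, x \in `]0, L[ -> P x}.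

Definition diffq f x : R -> R := fun y => (y - x)^-1 * (f y - f x).

(* Derivative of a function on the closed interval [0, L]: only values of f on
   [0, L] are used, so that it is one-sided at the two end points. *)
Definition derivableI L f x : Prop :=
  cvg (diffq f x y @[y --> within (`[0, L]%classic : set R) (dnbhs x)]).

Definition dI L f x : R :=
  lim (diffq f x y @[y --> within (`[0, L]%classic : set R) (dnbhs x)]).

Definition abs_cont L f : Prop :=
  forall eps : R, 0 < eps -> exists2 delta : R, 0 < delta &
    forall (n : nat) (x y : 'I_n -> R),
      (forall i, 0 <= x i /\ x i <= y i /\ y i <= L) ->
      trivIset [set: 'I_n] (fun i => `]x i, y i[%classic) ->
      \sum_(i < n) (y i - x i) < delta ->
      \sum_(i < n) `|f (y i) - f (x i)| < eps.

Definition L2 L f : Prop :=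
  measurable_fun `]0, L[ f /\
  mu.-integrable `]0, L[ (fun x => (f x ^+ 2)%:E).

Definition ip2 L f g : R := \int[mu]_(x in `]0, L[) (f x * g x).

Definition norm2 L f : R := Num.sqrt (ip2 L f f).

(* H^1(0, L), each class being given by its absolutely continuous
   representative on [0, L].  Absolute continuity implies the second clause,
   which only records that [dI L f] is the derivative almost everywhere. *)
Definition H1 L f : Prop :=
  [/\ abs_cont L f, ae_on L (derivableI L f) & L2 L (dI L f)].

(* H^2(0, L): f is C^1 on [0, L], and [dI L f] is the representative of f'
   that is continuous up to the end points. *)
Definition H2 L f : Prop :=
  [/\ H1 L f, forall x : R, x \in `[0, L] -> derivableI L f x & H1 L (dI L f)].

End OneDimension.

Inductive edge := e1 | e2 | e3.

Section Lasso.
Context {R : realType}.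
Variables a l : R.

Definition len (e : edge) : R := if e is e1 then l else a.

(* A function on the lasso: its three restrictions, u e x being meaningful for
   x in [0, len e]. *)
Definition gfun := edge -> R -> R.

Implicit Types (u phi psi q : gfun).

(* phi_r on (0, 2a) *)
Definition ring_part phi : R -> R :=
  fun x => if x < a then phi e2 x else phi e3 (a *+ 2 - x).

Definition gsub u phi : gfun := fun e x => u e x - phi e x.

Definition inH phi : Prop := forall e, L2 (len e) (phi e).

Definition ipH u phi : R :=
  ip2 l (u e1) (phi e1) + ip2 a (u e2) (phi e2) + ip2 a (u e3) (phi e3).

Definition normH phi : R := Num.sqrt (ipH phi phi).

Definition eqH u phi : Prop :=
  forall e, ae_on (len e) (fun x => u e x = phi e x).

Definition inH1 phi : Prop := H1 l (phi e1) /\ H1 (a *+ 2) (ring_part phi).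

Definition normH1 phi : R :=
  Num.sqrt (norm2 l (dI l (phi e1)) ^+ 2
            + norm2 (a *+ 2) (dI (a *+ 2) (ring_part phi)) ^+ 2
            + normH phi ^+ 2).

Definition inH10 phi : Prop :=
  [/\ inH1 phi,
      phi e1 0 = ring_part phi 0 &
      ring_part phi 0 = ring_part phi (a *+ 2)].

(* Continuity on the metric graph: on every closed edge, with a single value at
   each of the vertices x = 0 and x = a (midpoint of the ring). *)
Definition gcontinuous q : Prop :=
  [/\ forall e, {within `[0, len e], continuous (q e)},
      q e1 0 = q e2 0, q e1 0 = q e3 0 & q e2 a = q e3 a].

(* Derivatives pointing from the vertex into the edge e, at the ends x = 0 and
   x = len e respectively. *)
Definition dout0 phi (e : edge) : R := dI (len e) (phi e) 0.
Definition doutl phi (e : edge) : R := - dI (len e) (phi e) (len e).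

Definition opA q phi : gfun :=
  fun e x => - dI (len e) (dI (len e) (phi e)) x + q e x * phi e x.

Definition domA q phi : Prop :=
  (forall e, [/\ abs_cont (len e) (phi e),
                 forall x : R, x \in `[0, len e] -> derivableI (len e) (phi e) x &
                 abs_cont (len e) (dI (len e) (phi e))]) /\
  inH (opA q phi) /\
  doutl phi e1 = 0 /\
  (phi e2 a = phi e3 a /\ doutl phi e2 + doutl phi e3 = 0) /\
  (phi e1 0 = phi e2 0 /\ phi e1 0 = phi e3 0 /\
   dout0 phi e1 + dout0 phi e2 + dout0 phi e3 = 0).

Definition continuousH T (u : R -> gfun) : Prop :=
  (forall t : R, t \in `[0, T] -> inH (u t)) /\
  (forall t : R, t \in `[0, T] ->
     normH (gsub (u s) (u t)) @[s --> within (`[0, T]%classic : set R) (nbhs t)] --> 0).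

Definition moment (u : R -> gfun) phi : R -> R := fun t => ipH (u t) phi.

Definition solution q T (f1 f2 : R -> R) (u : R -> gfun) : Prop :=
  continuousH T u /\
  forall phi, domA q phi ->
    let m := moment u phi in
    [/\ H2 T m, m 0 = 0, dI T m 0 = 0 &
        ae_on T (fun t => dI T (dI T m) t + ipH (u t) (opA q phi)
                          = - f1 t * phi e1 l + f2 t * dout0 phi e2)].

(* u_t(., T) = psi *)
Definition velocity_at q T (u : R -> gfun) psi : Prop :=
  forall phi, domA q phi -> dI T (moment u phi) T = ipH psi phi.

End Lasso.

(* Main.v *)
Require Import Defs.
From mathcomp Require Import all_boot all_order all_algebra.
From mathcomp Require Import all_classical all_reals all_analysis.
From mathcomp Require Import measurable_realfun ring lra.
Set Implicit Arguments.
Unset Strict Implicit.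
Unset Printing Implicit Defensive.
Import Order.TTheory GRing.Theory Num.Theory.
Import numFieldNormedType.Exports.
Local Open Scope classical_set_scope.
Local Open Scope ring_scope.

(** If [phi] is an eigenfunction of the operator with eigenvalue [k ^+ 2], its moment
    [m] satisfies [m'' + k ^+ 2 * m = - f * phi e1 l], hence
    [m'(T) = - phi e1 l * \int_0^T f(t) cos (k (T - t)) dt].  So an eigenfunction
    vanishing at the boundary vertex has moment zero, and two eigenfunctions
    with boundary value 1 and frequencies at distance [e] have moments that
    differ by [O(e * norm2 T f)]; being orthogonal with norms bounded below,
    their difference is a target whose control cost is at least of order [1 / e].
    For every [e] one of the two cases occurs at some large frequency: if
    [n * l / a] is close to an integer, then both the [sin] and the [cos] wave of
    frequency [n * pi / a] almost satisfy the vertex conditions.  Since [q] only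
    perturbs the endpoint data of the solutions by [O(1 / k)], the symmetric
    2 x 2 matrix of the vertex conditions passes from negative to positive
    definite near that frequency, so that each of its two eigenvalues vanishes
    at some [k] there. *)

(** * Absolutely continuous functions *)

(** Every target used has zero displacement: then [normH1] contributes nothing and the cost is
    measured against the velocity alone. Solutions are generalized: m' is only absolutely continuous
    and its equation holds only almost everywhere. So the moment formula is used through increments:
    a covering argument bounds the increment of an absolutely continuous function by the integral of
    a bound for its derivative, and this is applied to the difference of two moments. The 2 x 2
    matrix arises by eliminating two of the coefficients of a candidate eigenfunction. Its unknowns
    are the value c at the boundary vertex and the scaled derivative s on [e3] at x = 0; it is
    symmetric because the Wronskians are 1. A kernel vector with c = 0 is an eigenfunction invisible
    from the boundary; two kernel vectors with c nonzero are rescaled to c = 1. If both eigenvalues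
    vanish at the same k, the kernel is the whole plane and contains a vector with c = 0. This
    dichotomy replaces precise knowledge of the spectrum, which depends on the arithmetic of l /
    a. *)

Section AbsolutelyContinuous.
Context {R : realType}.
Notation mu := (@lebesgue_measure R).

(** Continuity induction, replacing compactness: some point of S lies within r of its supremum, and
    P passes from it across the supremum, so the supremum is not below T. P may carry data
    accumulated from left to right, such as a finite family of intervals. *)
Lemma real_induction (P : R -> Prop) (T : R) : 0 <= T -> P 0 ->
  (forall s, 0 <= s <= T -> exists2 r, 0 < r & forall x y,
     0 <= x <= s -> s <= y <= T -> s - r < x -> y < s + r -> P x -> P y) ->
  P T.
Proof.
move=> T0 P0 step; pose S := [set x | 0 <= x <= T /\ P x].
have S0 : S 0 by split; rewrite ?lexx.
have hS : has_sup S.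
  by split; [exists 0|exists T => x [/andP[]]].
have s0 : 0 <= sup S by apply: ub_le_sup => //; exact: hS.2.
have sT : sup S <= T by apply: ge_sup; [exists 0|move=> x [/andP[]]].
have [|r r0 H] := step (sup S); first by rewrite s0.
have [x [x0T Px] sx] := sup_adherent r0 hS.
have xs : x <= sup S by apply: ub_le_sup; [exact: hS.2|split].
have [Tr|rT] := ltP T (sup S + r).
  by apply: (H x T) => //; rewrite ?lexx ?sT ?andbT//; case/andP: x0T => ->.
pose y := sup S + r / 2.
have yS : S y.
  split; first by rewrite /y; lra.
  by apply: (H x y) => //; rewrite /y; lra.
have : y <= sup S by apply: ub_le_sup; [exact: hS.2|].
by rewrite /y; lra.
Qed.

Lemma sum_itv_le_measure (O : set R) n (x y : 'I_n -> R) : open O ->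
  (forall i, x i <= y i) -> (forall i, `]x i, y i[ `<=` O) ->
  trivIset [set: 'I_n] (fun i => `]x i, y i[%classic) ->
  ((\sum_(i < n) (y i - x i))%:E <= mu O)%E.
Proof.
move=> oO xy xyO tI.
have -> : (\sum_(i < n) (y i - x i))%:E =
          (\sum_(i < n) mu `]x i, y i[%classic)%E.
  rewrite -sumEFin; apply: eq_bigr => i _.
  rewrite lebesgue_measure_itv/= lte_fin; case: ltP => // h.
  by congr (_%:E); have := xy i; lra.
rewrite -measure_semi_additive_ord//; last first.
  by apply: bigsetU_measurable => i _; exact: measurable_itv.
apply: le_measure; rewrite ?inE//.
- by apply: bigsetU_measurable => i _; exact: measurable_itv.
- exact: measurable_realfun.open_measurable.
- by elim/big_ind: _ => // A B AO BO z [/AO|/BO].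
Qed.

End AbsolutelyContinuous.

Section AbsContMonotone.
Context {R : realType}.
Notation mu := (@lebesgue_measure R).

Lemma negligible_open_cover (N : set R) (e : R) : 0 < e -> mu.-negligible N ->
  exists O : set R, [/\ open O, N `<=` O & (mu O < e%:E)%E].
Proof.
move=> e0 [A' [mA' A0' NA]].
have [A [mA A0 AE]] : exists A : set R, [/\ measurable A, mu A = 0%E & A = A'].
  by exists A'.
rewrite -{}AE in NA.
have [||O [oO AO Oe]] := @lebesgue_regularity_outer R A e _ _ e0.
- exact: mA.
- by apply: (@le_lt_trans _ _ 0%E) => //; rewrite -[X in (_ <= X)%E]A0.
exists O; split => //; first exact: subset_trans AO.
have mO : measurable O by exact: measurable_realfun.open_measurable.
have mOA : measurable (O `\` A) by exact: measurableD.
have -> : mu O = mu (O `\` A); last exact: Oe.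
rewrite -[in LHS](setDKU AO) measureU//; last by rewrite setIC setDIK.
rewrite -[RHS]adde0; congr (_ + _)%E; exact: A0.
Qed.

(** The hypothesis says that the lower derivative is nonnegative almost everywhere; multiplying the
    quotient by (y - s)^2 treats both sides of s at once. Off a small open set U containing the
    exceptional points H loses at most eta per unit length; inside U its variation is controlled by
    absolute continuity. *)
Lemma abs_cont_ge (H : R -> R) (T : R) : 0 < T -> abs_cont T H ->
  ae_on T (fun s => forall eta, 0 < eta -> exists2 r, 0 < r &
     forall y, 0 <= y <= T -> `|y - s| < r ->
       - eta * (y - s) ^+ 2 <= (H y - H s) * (y - s)) ->
  H 0 <= H T.
Proof.
move=> T0 acH bad.
suff main eta : 0 < eta -> H 0 - H T <= eta * T + eta.
  apply/ler_addgt0Pr => e e0.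
  have /main : 0 < e / (T + 1) by apply: divr_gt0 => //; lra.
  rewrite -[X in _ <= _ + X]mulr1 -mulrDr divfK; last by rewrite gt_eqF//; lra.
  lra.
move=> eta0; have [del del0 acHe] := acH _ eta0.
pose E := ~` [set s | s \in `]0, T[ -> forall eta, 0 < eta ->
   exists2 r, 0 < r & forall y, 0 <= y <= T -> `|y - s| < r ->
       - eta * (y - s) ^+ 2 <= (H y - H s) * (y - s)].
have negE : mu.-negligible (E `|` [set 0] `|` [set T]).
  apply: negligibleU; first apply: negligibleU.
  - exact: bad.
  - by exists [set 0]; split => //; exact: lebesgue_measure_set1.
  - by exists [set T]; split => //; exact: lebesgue_measure_set1.
have [U [oU EU Odel]] := negligible_open_cover del0 negE.
(* Invariant of the induction: the loss of H up to x is at most eta * x plus the variation over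
   finitely many disjoint intervals of U lying left of x. *)
pose P x := exists n (a b : 'I_n -> R),
  [/\ forall i, 0 <= a i /\ a i <= b i /\ b i <= x,
      forall i, `]a i, b i[ `<=` U,
      trivIset [set: 'I_n] (fun i => `]a i, b i[%classic) &
      H 0 - H x <= eta * x + \sum_(i < n) `|H (b i) - H (a i)|].
suff [n [a [b [ab abO tab HT]]]] : P T.
  apply: (le_trans HT); rewrite lerD2l ltW//; apply: acHe => //.
  rewrite -lte_fin; apply: le_lt_trans Odel.
  by apply: sum_itv_le_measure => // i; have [_ []] := ab i.
apply: real_induction; first exact: ltW.
  exists 0, (fun=> 0), (fun=> 0); split => //; try by case.
  by rewrite big_ord0 subrr mulr0 addr0.
move=> s /andP[s0 sT].
(* Around a point of U the whole step from x to y becomes a new interval, indexed by [ord_max]; it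
   is disjoint from the earlier ones, which end before x. *)
have [sO|sO] := pselect (U s).
  have [r /= r0 rO] : exists2 r, 0 < r & ball s r `<=` U.
    by have /open_nbhs_nbhs /nbhs_ballP[r] : open_nbhs s U by []; exists r.
  exists r => // x y /andP[x0 xs] /andP[sy yT] srx ysr.
  move=> [n [a [b [ab abO tab Hx]]]].
  pose a' (i : 'I_n.+1) := if unlift ord_max i is Some j then a j else x.
  pose b' (i : 'I_n.+1) := if unlift ord_max i is Some j then b j else y.
  have xy : x <= y by lra.
  exists n.+1, a', b'; split.
  - move=> i; rewrite /a' /b'; case: unliftP => [j _|_]; last by lra.
    by have := ab j; lra.
  - move=> i; rewrite /a' /b'; case: unliftP => [j _|_]; first exact: abO.
    apply: subset_trans rO => z/=; rewrite in_itv/= /ball/=.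
    by rewrite ltr_distl => /andP[? ?]; lra.
  - apply/trivIsetP => i j _ _; rewrite /a' /b'.
    case: unliftP => [i' ->|->]; case: unliftP => [j' ->|->].
    + rewrite (inj_eq lift_inj).
      by move/trivIsetP : tab => /(_ i' j' I I).
    + move=> _; apply/seteqP; split => // z [] /=; rewrite !in_itv/=.
      by have := ab i'; lra.
    + move=> _; apply/seteqP; split => // z [] /=; rewrite !in_itv/=.
      by have := ab j'; lra.
    + by rewrite eqxx.
  - rewrite big_ord_recr/=.
    have -> : \sum_(i < n) `|H (b' (widen_ord (leqnSn n) i)) -
        H (a' (widen_ord (leqnSn n) i))| = \sum_(i < n) `|H (b i) - H (a i)|.
      apply: eq_bigr => i _; rewrite /a' /b'.
      have -> : widen_ord (leqnSn n) i = lift ord_max i.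
        by apply/val_inj => /=; rewrite /bump leqNgt ltn_ord.
      by rewrite liftK.
    rewrite /a' /b' unlift_none.
    have : eta * x <= eta * y by rewrite ler_pM2l.
    have := ler_norm (H x - H y); rewrite distrC; lra.
(* Outside U the point is good and, U containing 0 and T, interior. The family is kept, and the loss
   is estimated separately from x to s and from s to y. *)
have /contrapT/(_ _ eta eta0)[|r r0 Hr] : ~ E s by move=> Es; apply/sO/EU; left; left.
  rewrite in_itv/= !lt_neqAle s0 sT !andbT; apply/andP; split.
    by apply/eqP => s0'; apply/sO/EU; left; right; rewrite /= s0'.
  by apply/eqP => s0'; apply/sO/EU; right; rewrite /= s0'.
exists r => // x y /andP[x0 xs] /andP[sy yT] srx ysr.
move=> [n [a [b [ab abO tab Hx]]]].
exists n, a, b; split => //.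
  by move=> i; have := ab i; lra.
have Hxs : H x - H s <= eta * (s - x).
  move: xs; rewrite le_eqVlt => /predU1P[->|xs]; first by rewrite !subrr mulr0.
  have /Hr : 0 <= x <= T by lra.
  have -> : `|x - s| < r by rewrite ltr_norml; lra.
  move=> /(_ isT) h; rewrite -(ler_pM2r (_ : 0 < s - x)); last by lra.
  by lra.
have Hsy : H s - H y <= eta * (y - s).
  move: sy; rewrite le_eqVlt => /predU1P[->|sy]; first by rewrite !subrr mulr0.
  have /Hr : 0 <= y <= T by lra.
  have -> : `|y - s| < r by rewrite ltr_norml; lra.
  move=> /(_ isT) h; rewrite -(ler_pM2r (_ : 0 < y - s)); last by lra.
  by lra.
lra.
Qed.

End AbsContMonotone.

(** * Derivatives relative to a closed interval *)

Section Derivatives.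
Context {R : realType}.

Lemma dnbhs_ballP (x : R) (A : set R) :
  dnbhs x A <-> exists2 r, 0 < r & forall y, `|y - x| < r -> y != x -> A y.
Proof.
split.
  move=> /nbhs_ballP[r /= r0 H]; exists r => // y yx ynx.
  by apply: H => //; rewrite /ball/= distrC.
move=> [r r0 H]; apply/nbhs_ballP; exists r => //= y.
by rewrite /ball/= distrC => yx ynx; exact: H.
Qed.

Lemma is_derive_approxP (f : R -> R) (x d : R) :
  is_derive x 1 f d <-> forall e, 0 < e -> exists2 r, 0 < r &
    forall y, `|y - x| < r -> `|f y - f x - d * (y - x)| <= e * `|y - x|.
Proof.
split.
  move=> [/cvg_ex[d' Hd']]; rewrite /derive.
  move/cvg_lim : (Hd') => -> // dd' e e0; move: Hd'; rewrite {}dd'.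
  move=> /cvgrPdist_le /(_ e e0) /dnbhs_ballP[r r0 H].
  exists r => // y yr; have [->|yx] := eqVneq y x.
    by rewrite !subrr mulr0 subrr normr0 mulr0.
  have yx0 : y - x != 0 by rewrite subr_eq0.
  have := H (y - x); rewrite subr0 => /(_ yr yx0).
  rewrite /GRing.scale/= mulr1 subrK -(ler_pM2r (_ : 0 < `|y - x|)) ?normr_gt0//.
  rewrite -normrM mulrBl mulrAC mulVf// mul1r.
  by rewrite distrC.
move=> H.
suff C : h^-1 *: (f (h *: 1 + x) - f x) @[h --> 0^'] --> d.
  by apply: DeriveDef; [apply/cvg_ex; exists d|apply/cvg_lim].
apply/cvgrPdist_le => e e0; have [r r0 Hr] := H e e0.
apply/dnbhs_ballP; exists r => // h; rewrite subr0 => hr h0.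
have := Hr (h *: 1 + x); rewrite /GRing.scale/= mulr1 addrK => /(_ hr) hh.
rewrite -(ler_pM2r (_ : 0 < `|h|)) ?normr_gt0// -normrM.
by rewrite mulrBl mulrAC mulVf// mul1r distrC.
Qed.

(** This makes the limit in [dI] unique: each point of [0, L], end points included, is approached by
    other points of [0, L], on the right unless x = L. *)
Lemma within_itv_proper (L x : R) : 0 < L -> 0 <= x <= L ->
  ProperFilter (within (`[0, L]%classic : set R) (dnbhs x)).
Proof.
move=> L0 /andP[x0 xL]; apply: Build_ProperFilter_ex => A.
move=> /dnbhs_ballP[r r0 H].
have [xL'|xL'] := ltP x L.
- set y := Num.min L (x + r / 2).
  have [xy yL yr] : [/\ x < y, y <= L & y < x + r].
    by rewrite /y; case: (leP L (x + r / 2)) => ?; split; lra.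
  exists y; apply: H; first by rewrite gtr0_norm; lra.
    by rewrite gt_eqF.
  by rewrite /= in_itv/=; lra.
- set y := Num.max 0 (x - r / 2).
  have [xy yL yr] : [/\ y < x, 0 <= y & x - r < y].
    by rewrite /y; case: (leP 0 (x - r / 2)) => ?; split; lra.
  exists y; apply: H; first by rewrite ltr0_norm; lra.
    by rewrite lt_eqF.
  by rewrite /= in_itv/=; lra.
Qed.

(** A first-order expansion without quotients: the point y = x is harmless and the restriction to
    [0, L] makes it one-sided at the ends. It is the bridge between [derivableI] and [is_derive]. *)
Definition approxI (L : R) (f : R -> R) (x d : R) := forall e, 0 < e -> exists2 r, 0 < r &
    forall y, 0 <= y <= L -> `|y - x| < r ->
      `|f y - f x - d * (y - x)| <= e * `|y - x|.

Lemma diffq_cvgP (L : R) f (x d : R) :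
  (diffq f x y @[y --> within (`[0, L]%classic : set R) (dnbhs x)] --> d) <->
  approxI L f x d.
Proof.
split.
  move=> /cvgrPdist_le H e e0; have [r r0 Hr] := (dnbhs_ballP _ _).1 (H e e0).
  exists r => // y yL yr; have [->|yx] := eqVneq y x.
    by rewrite !subrr mulr0 subrr normr0 mulr0.
  have yx0 : y - x != 0 by rewrite subr_eq0.
  have := Hr y yr yx; rewrite /= in_itv/= => /(_ yL).
  rewrite -(ler_pM2r (_ : 0 < `|y - x|)) ?normr_gt0//.
  rewrite -normrM mulrBl /diffq mulrAC mulVf// mul1r.
  by rewrite distrC.
move=> H; apply/cvgrPdist_le => e e0; have [r r0 Hr] := H e e0.
apply/dnbhs_ballP; exists r => // y yr yx; rewrite /= in_itv/= => yL.
have yx0 : y - x != 0 by rewrite subr_eq0.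
rewrite -(ler_pM2r (_ : 0 < `|y - x|)) ?normr_gt0// -normrM.
rewrite mulrBl /diffq mulrAC mulVf// mul1r distrC; exact: Hr.
Qed.

Lemma derivableIP (L : R) f x : 0 < L -> 0 <= x <= L ->
  derivableI L f x <-> approxI L f x (dI L f x).
Proof.
move=> L0 xL; have PF := within_itv_proper L0 xL; split.
  by move=> H; apply/diffq_cvgP.
by move=> /diffq_cvgP H; apply/cvg_ex; exists (dI L f x).
Qed.

Lemma approxI_dI (L : R) f x d : 0 < L -> 0 <= x <= L ->
  approxI L f x d -> derivableI L f x /\ dI L f x = d.
Proof.
move=> L0 xL /diffq_cvgP H; have PF := within_itv_proper L0 xL.
split; first by apply/cvg_ex; exists d.
exact/cvg_lim.
Qed.

Lemma is_derive_approxI (L : R) (f : R -> R) (x d : R) : is_derive x 1 f d -> approxI L f x d.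
Proof.
move=> /is_derive_approxP H e e0; have [r r0 Hr] := H e e0.
by exists r => // y _; exact: Hr.
Qed.

Lemma approxI_is_derive (L : R) (f : R -> R) (x d : R) : 0 < x < L -> approxI L f x d -> is_derive x 1 f d.
Proof.
move=> /andP[x0 xL] H; apply/is_derive_approxP => e e0.
have [r r0 Hr] := H e e0; exists (Num.min r (Num.min x (L - x))).
  by rewrite !lt_min; lra.
move=> y; rewrite !lt_min => /and3P[yr yx yL]; apply: Hr => //.
by move: yx yL; rewrite !ltr_norml; lra.
Qed.

Lemma approxI_eq (L : R) (f g : R -> R) (x d : R) : 0 <= x <= L ->
  (forall y, 0 <= y <= L -> f y = g y) -> approxI L f x d -> approxI L g x d.
Proof.
move=> xL fg H e e0; have [r r0 Hr] := H e e0; exists r => // y yL yr.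
by rewrite -!fg//; exact: Hr.
Qed.

End Derivatives.

(** * Algebra of absolutely continuous functions *)

Section AbsContTheory.
Context {R : realType}.
Notation mu := (@lebesgue_measure R).

Lemma abs_cont_unif (L : R) (f : R -> R) (e : R) : abs_cont L f -> 0 < e ->
  exists2 r, 0 < r & forall x y, 0 <= x <= L -> 0 <= y <= L -> `|y - x| < r ->
    `|f y - f x| < e.
Proof.
move=> acf e0; have [r r0 H] := acf e e0; exists r => //.
have main x y : 0 <= x -> x <= y -> y <= L -> y - x < r -> `|f y - f x| < e.
  move=> x0 xy yL yxr.
  have := H 1%N (fun=> x) (fun=> y); rewrite !big_ord1; apply => //.
  by apply/trivIsetP => i j _ _; rewrite !ord1 eqxx.
move=> x y /andP[x0 xL] /andP[y0 yL]; rewrite ltr_norml => /andP[? ?].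
have [xy|yx] := leP x y; first by apply: main => //; lra.
by rewrite distrC; apply: main => //; lra.
Qed.

(** Uniform continuity with tolerance 1 lets a bound on [0, x] extend past s at the price of adding
    |f s| + 1. *)
Lemma abs_cont_bounded (L : R) (f : R -> R) : 0 < L -> abs_cont L f ->
  exists2 M, 0 < M & forall x, 0 <= x <= L -> `|f x| <= M.
Proof.
move=> L0 /abs_cont_unif/(_ ltr01)[r r0 H].
apply: (@real_induction R (fun b => exists2 M, 0 < M & forall x, 0 <= x <= b -> `|f x| <= M)).
- exact: ltW.
- exists (`|f 0| + 1); first by rewrite ltr_wpDl.
  by move=> x /andP[x0 x0']; have -> : x = 0 by [lra]; rewrite lerDl.
move=> s sL; exists r => // x y xs sy sx ys [M M0 HM].
exists (M + `|f s| + 1); first by have := normr_ge0 (f s); lra.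
move=> z zy; have [zx|xz] := leP z x.
  have := HM z; have -> : 0 <= z <= x by lra.
  by move=> /(_ isT); have := normr_ge0 (f s); lra.
have := H s z sL; have -> : 0 <= z <= L by lra.
have -> : `|z - s| < r by rewrite ltr_norml; lra.
move=> /(_ isT isT); have := lerB_normD (f z) (- f s); rewrite normrN.
lra.
Qed.

Lemma abs_contD (L : R) (f g : R -> R) : abs_cont L f -> abs_cont L g ->
  abs_cont L (fun x => f x + g x).
Proof.
move=> acf acg e e0; have e2 : 0 < e / 2 by rewrite divr_gt0.
have [r r0 Hf] := acf _ e2; have [s s0 Hg] := acg _ e2.
exists (Num.min r s); first by rewrite lt_min r0.
move=> n x y xy tI; rewrite lt_min => /andP[xyr xys].
have := Hf n x y xy tI xyr; have := Hg n x y xy tI xys.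
suff : \sum_(i < n) `|f (y i) + g (y i) - (f (x i) + g (x i))| <=
       \sum_(i < n) `|f (y i) - f (x i)| + \sum_(i < n) `|g (y i) - g (x i)|.
  lra.
rewrite -big_split/=; apply: ler_sum => i _.
by rewrite opprD addrACA ler_normD.
Qed.

Lemma abs_contM (L : R) (f g : R -> R) : 0 < L -> abs_cont L f -> abs_cont L g ->
  abs_cont L (fun x => f x * g x).
Proof.
move=> L0 acf acg e e0.
have [M M0 fM] := abs_cont_bounded L0 acf.
have [N N0 gN] := abs_cont_bounded L0 acg.
have e1 : 0 < e / 2 / N by rewrite !divr_gt0.
have e2 : 0 < e / 2 / M by rewrite !divr_gt0.
have [r r0 Hf] := acf _ e1; have [s s0 Hg] := acg _ e2.
exists (Num.min r s); first by rewrite lt_min r0.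
move=> n x y xy tI; rewrite lt_min => /andP[xyr xys].
have := Hf n x y xy tI xyr; have := Hg n x y xy tI xys.
rewrite !ltr_pdivlMr// => h1 h2.
suff : \sum_(i < n) `|f (y i) * g (y i) - (f (x i) * g (x i))| <=
       \sum_(i < n) `|f (y i) - f (x i)| * N + \sum_(i < n) `|g (y i) - g (x i)| * M.
  rewrite -!mulr_suml; lra.
rewrite -big_split/=; apply: ler_sum => i _.
have -> : f (y i) * g (y i) - f (x i) * g (x i) =
  (f (y i) - f (x i)) * g (y i) + (g (y i) - g (x i)) * f (x i) by ring.
apply: (le_trans (ler_normD _ _)); rewrite !normrM lerD// ler_wpM2l//.
  by apply: gN; have := xy i; lra.
by apply: fM; have := xy i; lra.
Qed.

Lemma abs_cont_lipschitz (L K : R) (f : R -> R) :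
  (forall x y, 0 <= x -> x <= y -> y <= L -> `|f y - f x| <= K * (y - x)) ->
  abs_cont L f.
Proof.
move=> Hf e e0; exists (e / (`|K| + 1)).
  by rewrite divr_gt0// ltr_wpDl.
move=> n x y xy _; rewrite ltr_pdivlMr; last by rewrite ltr_wpDl.
apply: le_lt_trans; rewrite mulr_suml; apply: ler_sum => i _.
have [x0 [xyi yL]] := xy i; apply: (le_trans (Hf _ _ x0 xyi yL)).
rewrite mulrC ler_wpM2l//; first lra.
by have := ler_norm K; lra.
Qed.

Lemma derive_le_lipschitz (f df : R -> R) (K x y : R) : x <= y ->
  (forall z, x <= z <= y -> is_derive z 1 f (df z)) ->
  (forall z, x <= z <= y -> `|df z| <= K) -> `|f y - f x| <= K * (y - x).
Proof.
move=> xy fdf dfK.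
have [z| |z zxy ->] := @MVT_segment R f df x y xy.
- by rewrite in_itv/= => zxy; apply: fdf; lra.
- apply: derivable_within_continuous => z; rewrite in_itv/= => zxy.
  by have [] := fdf z zxy.
- rewrite normrM [X in _ * X]ger0_norm ?subr_ge0// ler_wpM2r ?subr_ge0//.
  by apply: dfK; move: zxy; rewrite in_itv/=.
Qed.

End AbsContTheory.

(** * Increments bounded by integrals *)

Section AbsContIntegral.
Context {R : realType}.
Notation mu := (@lebesgue_measure R).

Global Instance ae_on_filter (L : R) : Filter (@ae_on R L).
Proof.
have F := ae_filter_ringOfSetsType mu.
split.
- by apply: (@filterS _ (almost_everywhere mu) F setT) => //; exact: filterT.
- move=> P Q; rewrite /ae_on => hP hQ.
  by move: hP hQ; apply: (@filterS2 _ (almost_everywhere mu) F) => x hP hQ xL; split; [exact: hP|exact: hQ].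
- move=> P Q PQ; rewrite /ae_on.
  by apply: (@filterS _ (almost_everywhere mu) F) => x hP xL; exact/PQ/hP.
Qed.

(** G is the comparison function for [abs_cont_increment]: absolutely continuous by absolute
    continuity of the integral, differentiable almost everywhere by Lebesgue's theorem. *)
Lemma integral_primitive (T : R) (f : R -> R) : 0 < T ->
  mu.-integrable `]0, T[ (EFin \o f) ->
  exists G : R -> R, [/\ abs_cont T G, G T - G 0 = \int[mu]_(x in `]0, T[) `|f x| &
    ae_on T (fun x => is_derive x 1 G `|f x|)].
Proof.
move=> T0 intf.
(* The extension by zero is integrable on the line, so its primitive can start at -oo. *)
pose g := (fun x => `|f x|) \_ `]0%R, T[.
have intg : mu.-integrable setT (EFin \o g).
  rewrite /g -restrict_EFin; apply/integrable_restrict => //=; rewrite setTI.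
  exact: integrable_abse intf.
have intgS (A : set R) : measurable A -> mu.-integrable A (EFin \o g).
  by move=> mA; exact: integrableS intg.
have g0 x : 0 <= g x by rewrite /g patchE; case: ifPn.
pose G x := \int[mu]_(t in `]-oo, x]) g t.
have GB x y : x <= y -> G y - G x = \int[mu]_(t in `]x, y[) g t.
  move=> xy; rewrite /G Rintegral_itvB//; last exact: intgS.
  by rewrite -Rintegral_itv_bndo_bndc//; exact: intgS.
exists G; split.
- move=> e e0; have [d [d0 Hd]] := integral_normr_continuous intg e0.
  exists d => // n x y xy tI xyd.
  have mxy (i : 'I_n) : measurable (`]x i, y i[%classic : set R) by exact: measurable_itv.
  have -> : \sum_(i < n) `|G (y i) - G (x i)| =
      \int[mu]_(t in \big[setU/set0]_(i < n) `]x i, y i[%classic) `|g t|.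
    have -> : (fun t => `|g t|) = g by apply/funext => t; rewrite ger0_norm.
    rewrite /Rintegral integral_bigsetU_EFin//.
    + rewrite -sum_fine; last by move=> i _; apply: integrable_fin_num => //; exact: intgS.
      apply: eq_bigr => i _; have [_ [xyi _]] := xy i.
      by rewrite GB// ger0_norm//; exact: Rintegral_ge0.
    + exact: index_enum_uniq.
    + by apply: sub_trivIset tI.
    + have /intgS/integrableP[]// :
        measurable (\big[setU/set0]_(i < n) `]x i, y i[%classic : set R).
      exact: bigsetU_measurable.
  apply: Hd.
    by apply: bigsetU_measurable.
  rewrite measure_semi_additive_ord//; last by apply: bigsetU_measurable.
  apply: le_lt_trans (_ : _ <= (\sum_(i < n) (y i - x i))%:E)%E _; last by rewrite lte_fin.
  rewrite -sumEFin; apply: lee_sum => i _.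
  change (mu `]x i, y i[%classic <= (y i - x i)%:E)%E.
  rewrite lebesgue_measure_itv/= lte_fin; case: ltP => // h.
  by rewrite lee_fin subr_ge0; have [_ []] := xy i.
- rewrite GB ?ltW//; apply: eq_Rintegral => x xT.
  by rewrite /g patchE xT.
- have lg : locally_integrable [set: R] g.
    by apply: open_integrable_locally => //; exact: openT.
  have := FTC1Ny (fun y => intgS _ (measurable_itv _)) lg.
  apply: filterS; first exact: (ae_filter_ringOfSetsType mu).
  move=> x [dG G'x] xT.
  have <- : g x = `|f x| by rewrite /g patchE mem_setE xT.
  by apply: DeriveDef; [exact: dG|rewrite -derive1E; exact: G'x].
Qed.

(** With G the primitive of |f|, both G - W and G + W have nonnegative derivative almost everywhere,
    hence increase by [abs_cont_ge]. *)
Lemma abs_cont_increment (T : R) (W f : R -> R) : 0 < T -> abs_cont T W ->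
  mu.-integrable `]0, T[ (EFin \o f) ->
  ae_on T (fun x => exists2 d, is_derive x 1 W d & `|d| <= `|f x|) ->
  `|W T - W 0| <= \int[mu]_(x in `]0, T[) `|f x|.
Proof.
move=> T0 acW intf aeW; have [G [acG <- aeG]] := integral_primitive T0 intf.
suff main s : `|s| = 1 -> s * (W T - W 0) <= G T - G 0.
  have := main 1; rewrite normr1 mul1r => /(_ erefl) h1.
  have := main (-1); rewrite normrN normr1 mulN1r => /(_ erefl) h2.
  by rewrite ler_norml; lra.
move=> s1.
have acH : abs_cont T (fun x => G x + (- s) * W x).
  apply: abs_contD => //; apply: abs_contM => //.
  by apply: (@abs_cont_lipschitz _ _ 0) => *; rewrite subrr normr0 mul0r.
suff : G 0 + (- s) * W 0 <= G T + (- s) * W T by rewrite mulrBr; lra.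
apply: (abs_cont_ge T0 acH); move: aeW aeG; apply: filterS2 => x hW dG eta eta0.
have [d dW df] := hW.
have e0 : 0 < eta / 2 by rewrite divr_gt0.
have [r r0 HW] := (is_derive_approxP _ _ _).1 dW _ e0.
have [r' r'0 HG] := (is_derive_approxP _ _ _).1 dG _ e0.
exists (Num.min r r'); first by rewrite lt_min r0.
move=> y yT; rewrite lt_min => /andP[yr yr'].
have {HW} := HW y yr; have {HG} := HG y yr'.
set A := G y - G x - _; set B := W y - W x - _ => hA hB.
(* The slope |f x| - s * d is nonnegative; the remainders A and B of the two expansions cost eta / 2
   each. *)
have -> : (G y + - s * W y - (G x + - s * W x)) * (y - x) =
   (`|f x| - s * d) * (y - x) ^+ 2 + (A - s * B) * (y - x).
  by rewrite /A /B; ring.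
have h1 : 0 <= (`|f x| - s * d) * (y - x) ^+ 2.
  rewrite mulr_ge0 ?sqr_ge0// subr_ge0; apply: le_trans (ler_norm _) _.
  by rewrite normrM s1 mul1r.
have h2 : `|(A - s * B) * (y - x)| <= eta * (y - x) ^+ 2.
  rewrite normrM -real_normK ?num_real// expr2 mulrA ler_wpM2r//.
  by apply: (le_trans (ler_normB _ _)); rewrite normrM s1 mul1r; lra.
by move: h2; rewrite ler_norml => /andP[]; lra.
Qed.

End AbsContIntegral.

(** * Square integrable functions and moments against eigenfunctions *)

Section Moments.
Context {R : realType}.
Notation mu := (@lebesgue_measure R).

Lemma is_derive_cos_affine (k c x : R) :
  is_derive x 1 (fun t => cos (k * t + c)) (- k * sin (k * x + c)).
Proof.
have h : is_derive x 1 (fun t : R => k * t + c) k.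
  by apply: is_derive_eq; rewrite /GRing.scale/= mulr1 addr0.
have := @is_derive1_comp R cos (fun t => k * t + c) x _ _ (is_derive_cos _) h.
by rewrite mulNr mulrC -mulNr.
Qed.

Lemma is_derive_sin_affine (k c x : R) :
  is_derive x 1 (fun t => sin (k * t + c)) (k * cos (k * x + c)).
Proof.
have h : is_derive x 1 (fun t : R => k * t + c) k.
  by apply: is_derive_eq; rewrite /GRing.scale/= mulr1 addr0.
have := @is_derive1_comp R sin (fun t => k * t + c) x _ _ (is_derive_sin _) h.
by rewrite mulrC.
Qed.

Lemma cos_lipschitz (x y : R) : `|cos y - cos x| <= `|y - x|.
Proof.
wlog xy : x y / x <= y.
  move=> H; have [/H//|/ltW/H] := leP x y.
  by rewrite distrC (distrC x).
rewrite -[leRHS]mul1r (@ger0_norm _ (y - x)) ?subr_ge0//.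
apply: (@derive_le_lipschitz _ _ (fun x => - sin x)) => // z _.
by rewrite normrN ler_norml sin_geN1 sin_le1.
Qed.

Lemma sin_lipschitz (x y : R) : `|sin y - sin x| <= `|y - x|.
Proof.
wlog xy : x y / x <= y.
  move=> H; have [/H//|/ltW/H] := leP x y.
  by rewrite distrC (distrC x).
rewrite -[leRHS]mul1r (@ger0_norm _ (y - x)) ?subr_ge0//.
apply: (@derive_le_lipschitz _ _ (@cos R)) => // z _.
by rewrite ler_norml cos_geN1 cos_le1.
Qed.

Lemma itvoo_integrableZl (L k : R) (f : R -> R) :
  mu.-integrable `]0, L[ (EFin \o f) ->
  mu.-integrable `]0, L[ (EFin \o (fun x => k * f x)).
Proof.
have -> : EFin \o (fun x => k * f x) = (fun x => k%:E * (EFin \o f) x)%E by [].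
exact: integrableZl.
Qed.

Lemma itvoo_integrableD (L : R) (f g : R -> R) :
  mu.-integrable `]0, L[ (EFin \o f) -> mu.-integrable `]0, L[ (EFin \o g) ->
  mu.-integrable `]0, L[ (EFin \o (fun x => f x + g x)).
Proof.
have -> : EFin \o (fun x => f x + g x) = (EFin \o f) \+ (EFin \o g) by [].
exact: integrableD.
Qed.

Lemma L2_integrableM (L : R) (f g : R -> R) : L2 L f -> L2 L g ->
  mu.-integrable `]0, L[ (EFin \o (fun x => f x * g x)).
Proof.
move=> [mf f2] [mg g2].
have fg2 : mu.-integrable `]0, L[ (EFin \o (fun x => f x ^+ 2 + g x ^+ 2)).
  exact: itvoo_integrableD.
apply: le_integrable fg2 => //.
  by apply/measurable_realfun.measurable_EFinP; apply: measurable_funM.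
move=> x _; rewrite lee_fin [leRHS]ger0_norm ?addr_ge0 ?sqr_ge0//.
rewrite normrM -[f x ^+ 2]real_normK ?num_real// -[g x ^+ 2]real_normK ?num_real//.
have := sqr_ge0 (`|f x| - `|g x|).
have := mulr_ge0 (normr_ge0 (f x)) (normr_ge0 (g x)); nra.
Qed.

Lemma integrable_itvoo_continuous (L : R) (f : R -> R) :
  {within `[0, L], continuous f} -> mu.-integrable `]0, L[ (EFin \o f).
Proof.
move=> cf; apply: (@integrableS _ _ _ mu `[0, L]) => //.
  exact: subset_itv_oo_cc.
by apply: continuous_compact_integrable => //; exact: segment_compact.
Qed.

Lemma L2_continuous (L : R) (f : R -> R) : {within `[0, L], continuous f} -> L2 L f.
Proof.
move=> cf; split.
  have /integrableP[/measurable_EFinP] := integrable_itvoo_continuous cf; exact.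
rewrite (_ : (fun x => _) = EFin \o (fun x => f x * f x)); last first.
  by apply/funext => x /=; rewrite expr2.
by apply: integrable_itvoo_continuous => x; apply: cvgM; exact: cf.
Qed.

Lemma L2_cst (L c : R) : L2 L (fun _ => c).
Proof. by apply: L2_continuous => x; exact: cvg_cst. Qed.

Lemma L2_eq (L : R) (f g : R -> R) : (forall x, 0 < x < L -> f x = g x) ->
  L2 L f -> L2 L g.
Proof.
move=> fg [mf If]; split.
  by apply: eq_measurable_fun mf => x /set_mem/=; rewrite in_itv/= => /fg.
by apply: eq_integrable If => // x /set_mem/=; rewrite in_itv/= => /fg ->.
Qed.

Lemma L2_integrable (L : R) (f : R -> R) : L2 L f ->
  mu.-integrable `]0, L[ (EFin \o f).
Proof.
move=> hf; have := L2_integrableM hf (L2_cst L 1).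
by apply: eq_integrable => // x _ /=; rewrite mulr1.
Qed.

Lemma L2Z (L k : R) (f : R -> R) : L2 L f -> L2 L (fun x => k * f x).
Proof.
move=> [mf If]; split; first exact: measurable_funM.
have := itvoo_integrableZl (k ^+ 2) If.
apply: eq_integrable => // x _ /=.
by rewrite exprMn.
Qed.

Lemma L2D (L : R) (f g : R -> R) : L2 L f -> L2 L g -> L2 L (fun x => f x + g x).
Proof.
move=> hf hg; split; first by apply: measurable_funD; [case: hf|case: hg].
have h1 := hf.2; have h2 := hg.2; have h3 := L2_integrableM hf (L2Z 2 hg).
have := itvoo_integrableD (itvoo_integrableD h1 h2) h3.
apply: eq_integrable => // x _ /=.
by congr (_%:E); ring.
Qed.

Lemma ip2Zr (L k : R) (f g h : R -> R) : (forall x, 0 < x < L -> h x = k * g x) ->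
  L2 L f -> L2 L g -> ip2 L f h = k * ip2 L f g.
Proof.
move=> hg hf Lg; rewrite /ip2 -RintegralZl//; last exact: L2_integrableM.
apply: eq_Rintegral => x /set_mem/=; rewrite in_itv/= => /hg ->.
by rewrite mulrCA.
Qed.

Lemma ip2Dr (L : R) (f g h : R -> R) : L2 L f -> L2 L g -> L2 L h ->
  ip2 L f (fun x => g x + h x) = ip2 L f g + ip2 L f h.
Proof.
move=> hf hg hh; rewrite /ip2 -RintegralD//; try exact: L2_integrableM.
by apply: eq_Rintegral => x _; rewrite mulrDr.
Qed.

Lemma ip2C (L : R) (f g : R -> R) : ip2 L f g = ip2 L g f.
Proof. by apply: eq_Rintegral => x _; rewrite mulrC. Qed.

Lemma ip2_ge0 (L : R) (f : R -> R) : 0 <= ip2 L f f.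
Proof. by apply: Rintegral_ge0 => x _; rewrite -expr2 sqr_ge0. Qed.

Lemma norm2_sqr (L : R) (f : R -> R) : norm2 L f ^+ 2 = ip2 L f f.
Proof. by rewrite sqr_sqrtr// ip2_ge0. Qed.

(** Integrate the pointwise bound |f| <= s + f^2 / s, which is a square being nonnegative. Taking s
    equal to the norm gives the constant T + 1; if the norm vanishes, s is taken arbitrarily
    small. *)
Lemma L1_le_norm2 (T : R) (f : R -> R) : 0 < T -> L2 T f ->
  \int[mu]_(x in `]0, T[) `|f x| <= (T + 1) * norm2 T f.
Proof.
move=> T0 hf.
have Iabs : mu.-integrable `]0, T[ (EFin \o (fun x => `|f x|)).
  exact: integrable_abse (L2_integrable hf).
have Isq : mu.-integrable `]0, T[ (EFin \o (fun x => f x * f x)).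
  exact: L2_integrableM.
have muT : fine (mu `]0, T[) = T.
  by rewrite lebesgue_measure_itv/= lte_fin T0/= subr0.
have key s : 0 < s -> \int[mu]_(x in `]0, T[) `|f x| <= s * T + s^-1 * norm2 T f ^+ 2.
  move=> s0.
  have Is : mu.-integrable `]0, T[ (EFin \o (fun _ : R => s)).
    exact: L2_integrable (L2_cst T s).
  have Isq' : mu.-integrable `]0, T[ (EFin \o (fun x => s^-1 * (f x * f x))).
    exact: itvoo_integrableZl.
  have -> : s * T + s^-1 * norm2 T f ^+ 2 =
      \int[mu]_(x in `]0, T[) (s + s^-1 * (f x * f x)).
    rewrite RintegralD// RintegralZl// norm2_sqr Rintegral_cst//.
    by congr (_ * _ + _); rewrite -[LHS]muT.
  apply: le_Rintegral => //.
    exact: itvoo_integrableD.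
  move=> x _; have : 0 <= s^-1 * (`|f x| - s) ^+ 2 + `|f x|.
    by rewrite addr_ge0// mulr_ge0 ?sqr_ge0// invr_ge0 ltW.
  rewrite -[f x * f x]expr2 -[f x ^+ 2]real_normK ?num_real//.
  have -> : s^-1 * (`|f x| - s) ^+ 2 = s^-1 * `|f x| ^+ 2 - 2 * `|f x| + s.
    by field; rewrite gt_eqF.
  lra.
have N0 : 0 <= norm2 T f by exact: sqrtr_ge0.
move: N0; rewrite le_eqVlt => /predU1P[N0|N0].
  rewrite -N0 mulr0; apply/ler_addgt0Pr => e e0.
  have := key (e / T) (divr_gt0 e0 T0).
  by rewrite -N0 expr0n/= mulr0 addr0 divfK ?gt_eqF// add0r.
apply: (le_trans (key _ N0)); rewrite expr2 mulrA mulVf ?gt_eqF//.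
by rewrite mul1r mulrDl mul1r [X in X + _]mulrC.
Qed.

End Moments.

(** * Moments against eigenfunctions *)

Section EigenMoments.
Context {R : realType}.
Notation mu := (@lebesgue_measure R).
Variables (a l : R) (q : @gfun R).

(** The zero function qualifies for every k; it is the term of comparison for an eigenfunction
    vanishing at the boundary vertex. *)
Definition eigenmode (k : R) (phi : gfun) : Prop :=
  [/\ domA a l q phi, inH a l phi &
      forall e x, 0 < x < len a l e -> opA a l q phi e x = k ^+ 2 * phi e x].

Lemma ipHZr (k : R) (u phi psi : gfun) :
  (forall e x, 0 < x < len a l e -> psi e x = k * phi e x) ->
  inH a l u -> inH a l phi -> ipH a l u psi = k * ipH a l u phi.
Proof.
move=> h hu hphi; rewrite /ipH !mulrDr; congr (_ + _ + _); apply: ip2Zr.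
- exact: (h e1).
- exact: (hu e1).
- exact: (hphi e1).
- exact: (h e2).
- exact: (hu e2).
- exact: (hphi e2).
- exact: (h e3).
- exact: (hu e3).
- exact: (hphi e3).
Qed.

Lemma abs_cont_cos_affine (L k c : R) : abs_cont L (fun t => cos (k * t + c)).
Proof.
apply: (@abs_cont_lipschitz _ _ `|k|) => x y _ xy _.
apply: (le_trans (cos_lipschitz _ _)).
by rewrite opprD addrACA subrr addr0 -mulrBr normrM [X in _ * X]ger0_norm ?subr_ge0.
Qed.

Lemma abs_cont_sin_affine (L k c : R) : abs_cont L (fun t => sin (k * t + c)).
Proof.
apply: (@abs_cont_lipschitz _ _ `|k|) => x y _ xy _.
apply: (le_trans (sin_lipschitz _ _)).
by rewrite opprD addrACA subrr addr0 -mulrBr normrM [X in _ * X]ger0_norm ?subr_ge0.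
Qed.

(* Variation of constants for m'' + k^2 m = - f phi_1(l). *)
Lemma eigenmode_moment (k T : R) (f : R -> R) (u : R -> gfun) (phi : gfun) :
  0 < T -> eigenmode k phi -> solution a l q T f (fun _ => 0) u ->
  let m := moment a l u phi in
  exists W : R -> R, [/\ abs_cont T W, W 0 = 0, W T = dI T m T &
    ae_on T (fun t => is_derive t 1 W (- f t * phi e1 l * cos (- k * t + k * T)))].
Proof.
move=> T0 [Dphi Hphi Ephi] [[uH _] /(_ _ Dphi)]; set m := moment a l u phi.
move=> [[[acm _ _] dm [acdm aedm _]] m0 dm0 aem] /=.
(* W(t) = m'(t) cos (k (T - t)) - k m(t) sin (k (T - t)): the m' terms of its derivative cancel,
   leaving (m'' + k^2 m) cos (k (T - t)), and the phase vanishes at t = T. *)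
exists (fun t => dI T m t * cos (- k * t + k * T) + (- k * m t) * sin (- k * t + k * T)).
split.
- apply: abs_contD; apply: abs_contM => //.
  + exact: abs_cont_cos_affine.
  + apply: abs_contM => //; apply: (@abs_cont_lipschitz _ _ 0) => *.
    by rewrite subrr normr0 mul0r.
  + exact: abs_cont_sin_affine.
- by rewrite m0 dm0 mulr0 !mul0r addr0.
- by rewrite mulNr addNr cos0 sin0 mulr1 mulr0 addr0.
have aet : ae_on T (fun t => 0 < t < T).
  rewrite /ae_on; apply: aeW => t; by rewrite in_itv.
move: aet aem aedm; apply: filterS3 => t /[dup] tT /andP[t0 t1] Em ddm.
have tT' : 0 <= t <= T by rewrite !ltW.
have d1 : is_derive t 1 m (dI T m t).
  apply: (approxI_is_derive tT); apply/derivableIP => //.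
  by apply: dm; rewrite in_itv.
have d2 : is_derive t 1 (dI T m) (dI T (dI T m) t).
  by apply: (approxI_is_derive tT); apply/derivableIP.
have dc := is_derive_cos_affine (- k) (k * T) t.
have ds := is_derive_sin_affine (- k) (k * T) t.
have ->: - f t * phi e1 l * cos (- k * t + k * T) =
  (dI T (dI T m) t + ipH a l (u t) (opA a l q phi)) * cos (- k * t + k * T).
  by rewrite Em mul0r addr0.
have Hu : inH a l (u t) by apply: uH; rewrite in_itv.
rewrite (ipHZr Ephi Hu Hphi).
rewrite -/(moment a l u phi t) -/m.
apply: is_derive_eq; rewrite /GRing.scale/=; ring.
Qed.

(** With a common boundary value the derivatives of the two functions W differ by f times a
    difference of cosines, at most |k - k'| * T. Taking [phi'] zero and k = k' also covers an
    eigenfunction vanishing at the boundary vertex. *)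
Lemma velocity_gap (k k' T : R) (f : R -> R) (u : R -> gfun) (phi phi' psi : gfun) :
  0 < T -> eigenmode k phi -> eigenmode k' phi' -> phi e1 l = phi' e1 l ->
  L2 T f -> solution a l q T f (fun _ => 0) u -> velocity_at a l q T u psi ->
  `|ipH a l psi phi - ipH a l psi phi'| <=
     `|phi e1 l| * `|k - k'| * T * ((T + 1) * norm2 T f).
Proof.
move=> T0 mphi mphi' pl fL2 sol vel.
have [W [acW W0 WT dW]] := eigenmode_moment T0 mphi sol.
have [V [acV V0 VT dV]] := eigenmode_moment T0 mphi' sol.
have vphi := vel _ (let: And3 h _ _ := mphi in h).
have vphi' := vel _ (let: And3 h _ _ := mphi' in h).
rewrite -vphi -vphi' -WT -VT.
pose Z t := W t + (- 1) * V t.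
have -> : W T - V T = Z T - Z 0 by rewrite /Z W0 V0; ring.
pose K := `|phi e1 l| * `|k - k'| * T.
have K0 : 0 <= K by rewrite !mulr_ge0// ltW.
have acZ : abs_cont T Z.
  apply: abs_contD => //; apply: abs_contM => //.
  by apply: (@abs_cont_lipschitz _ _ 0) => *; rewrite subrr normr0 mul0r.
have IKf := itvoo_integrableZl K (L2_integrable fL2).
apply: le_trans (abs_cont_increment T0 acZ IKf _) _.
  have aet : ae_on T (fun t => 0 < t < T).
    rewrite /ae_on; apply: aeW => t; by rewrite in_itv.
  move: aet dW dV; apply: filterS3 => t /andP[t0 tT] dWt dVt.
  exists (- f t * phi e1 l * cos (- k * t + k * T) -
          (- f t * phi' e1 l * cos (- k' * t + k' * T))).
    by rewrite /Z; apply: is_derive_eq; rewrite /GRing.scale/=; ring.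
  rewrite -pl -mulrBr [leRHS]normrM (ger0_norm K0) normrM normrM normrN.
  rewrite [leRHS]mulrC -mulrA ler_wpM2l// /K -mulrA ler_wpM2l//.
  apply: (le_trans (cos_lipschitz _ _)).
  have -> : - k * t + k * T - (- k' * t + k' * T) = (k - k') * (T - t) by ring.
  have Tt : 0 <= T - t by rewrite subr_ge0 ltW.
  rewrite normrM (ger0_norm Tt); apply: ler_wpM2l; first exact: normr_ge0.
  by rewrite lerBlDr lerDl ltW.
rewrite -/K; have -> : \int[mu]_(x in `]0, T[) `|K * f x| = K * \int[mu]_(x in `]0, T[) `|f x|.
  rewrite -RintegralZl//; last exact: integrable_abse (L2_integrable fL2).
  by apply: eq_Rintegral => x _; rewrite normrM (ger0_norm K0).
by rewrite ler_wpM2l// L1_le_norm2.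
Qed.

End EigenMoments.

(** * The oscillator y'' = (p - k^2) y *)

Section Primitive.
Context {R : realType}.
Notation mu := (@lebesgue_measure R).

(** The integral needs a base point to the left of both 0 and x, so the base moves with x. Near [x0]
    it can be replaced by the fixed b, the difference of two integrals from a common base being
    independent of it. *)
Lemma continuous_primitive (h : R -> R) : continuous h ->
  exists H : R -> R, H 0 = 0 /\ forall x : R, is_derive x 1 H (h x).
Proof.
move=> ch.
have Ih b x : mu.-integrable `[b, x] (EFin \o h).
  apply: continuous_compact_integrable; first exact: segment_compact.
  exact: continuous_subspaceT.
pose P b x := \int[mu]_(t in `[b, x]) h t.
have PB b c x : b <= c -> c <= x -> P c x = P b x - P b c.
  move=> bc cx; rewrite /P Rintegral_itvB ?bnd_simp//.
  by rewrite -Rintegral_itv_obnd_cbnd//; apply: integrableS (Ih c x) => //; exact: subset_itv_oc_cc.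
pose H x := P (- (`|x| + 1)) x - P (- (`|x| + 1)) 0.
exists H; split; first by rewrite /H subrr.
move=> x0; pose b := - (`|x0| + 2).
have HE x : `|x - x0| < 1 -> H x = P b x - P b 0.
  move=> xx0; have bx : b <= - (`|x| + 1).
    rewrite /b; have := lerB_normD x (- x0); rewrite normrN => ?.
    lra.
  have x1 : - (`|x| + 1) <= x by have := ler_norm (- x); rewrite normrN; lra.
  have x2 : - (`|x| + 1) <= 0 by have := normr_ge0 x; lra.
  by rewrite /H (PB b)// (PB b _ 0)//; ring.
have [dP PE] : derivable (P b) x0 1 /\ (P b)^`()%classic x0 = h x0.
  apply: (@continuous_FTC1_closed _ h b x0 (x0 + 1)) => //.
  - by rewrite ltrDl.
  - by rewrite /b; have := ler_norm (- x0); rewrite normrN; lra.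
  - exact: ch.
have : is_derive x0 1 (P b) (h x0).
  by apply: DeriveDef; [exact: dP|rewrite -derive1E; exact: PE].
move=> /is_derive_approxP D; apply/is_derive_approxP => e e0.
have [r r0 Hr] := D e e0; exists (Num.min r 1); first by rewrite lt_min r0 ltr01.
move=> y; rewrite lt_min => /andP[yr y1].
rewrite !HE ?subrr ?normr0//.
have -> : P b y - P b 0 - (P b x0 - P b 0) = P b y - P b x0 by ring.
exact: Hr.
Qed.

(** Banach's theorem in the uniform norm with ratio 1/2: the iterates from 0 are uniformly Cauchy,
    so the limit is continuous; comparing Phi z with a late iterate shows that z is fixed. *)
Lemma contraction_fixpoint (Phi : (R -> R) -> R -> R) (M0 : R) :
  (forall y, continuous y -> continuous (Phi y)) ->
  (forall x, `|Phi (fun=> 0) x| <= M0) ->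
  (forall y z M, continuous y -> continuous z ->
     (forall x, `|y x - z x| <= M) -> forall x, `|Phi y x - Phi z x| <= M / 2) ->
  exists2 y, continuous y & forall x, Phi y x = y x.
Proof.
move=> cPhi Phi0 ctr; pose y n := iter n Phi (fun=> 0).
have cy n : continuous (y n).
  by elim: n => [|n IH]; [exact: cst_continuous|exact: cPhi].
have M00 : 0 <= M0 by apply: le_trans (Phi0 0).
have stepy n x : `|y n.+1 x - y n x| <= M0 * 2^-1 ^+ n.
  elim: n x => [|n IH] x; first by rewrite expr0 mulr1 subr0; exact: Phi0.
  by rewrite exprSr mulrA; exact: (ctr _ _ _ (cy n.+1) (cy n) IH).
have dist n k x : `|y (n + k)%N x - y n x| <= 2 * M0 * 2^-1 ^+ n.
  suff : `|y (n + k)%N x - y n x| <= 2 * M0 * 2^-1 ^+ n * (1 - 2^-1 ^+ k).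
    have hk : 0 <= (2^-1 : R) ^+ k by rewrite exprn_ge0// invr_ge0.
    have hn : 0 <= (2^-1 : R) ^+ n by rewrite exprn_ge0// invr_ge0.
    move=> h; apply: (le_trans h); apply: ler_piMr; last by lra.
    by rewrite !mulr_ge0.
  elim: k => [|k IH]; first by rewrite addn0 !subrr normr0 mulr0.
  rewrite addnS; have := stepy (n + k)%N x.
  have := ler_normD (y (n + k).+1 x - y (n + k)%N x) (y (n + k)%N x - y n x).
  rewrite addrA subrK exprD exprS.
  move: IH; set a := (2^-1 : R) ^+ n; set b := (2^-1 : R) ^+ k; lra.
have small e : 0 < e -> exists N, forall n, (N <= n)%N -> 2 * M0 * 2^-1 ^+ n < e.
  move=> e0.
  have : (2 * M0) *: (2^-1 ^+ n : R) @[n --> \oo] --> (2 * M0) *: (0 : R).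
    by apply: cvgZr; apply: cvg_expr; rewrite ger0_norm ?invr_ge0// invf_lt1// ltr1n.
  rewrite scaler0 => /cvgrPdist_lt/(_ e e0)[N _ HN]; exists N => n /HN/=.
  by rewrite sub0r normrN; apply: le_lt_trans; exact: ler_norm.
have cvgy x : cvg (y n x @[n --> \oo]).
  apply/cauchy_cvgP/cauchy_exP => e e0; have [N HN] := small e e0.
  exists (y N x); exists N => // n /= Nn; rewrite /ball/= distrC.
  rewrite -(subnKC Nn); apply: le_lt_trans (HN N (leqnn N)).
  exact: dist.
pose z x := lim (y n x @[n --> \oo]).
have zy n x : `|z x - y n x| <= 2 * M0 * 2^-1 ^+ n.
  apply/ler_addgt0Pr => e e0.
  have /cvgrPdist_lt/(_ e e0)[N _ HN] := cvgy x.
  have := HN (n + N)%N (leq_addl _ _); have := dist n N x.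
  have := ler_normD (z x - y (n + N)%N x) (y (n + N)%N x - y n x).
  by rewrite addrA subrK /= -/(z x); lra.
have cz : continuous z.
  move=> x; apply/cvgrPdist_lt => e e0.
  have e3 : 0 < e / 3 by rewrite divr_gt0.
  have [N HN] := small _ e3.
  have /cvgrPdist_lt/(_ _ e3) := cy N x; apply: filterS => t /= ht.
  have := zy N x; have := zy N t; have := HN N (leqnn N).
  have -> : z x - z t = (z x - y N x) + (y N x - y N t) + (y N t - z t) by ring.
  have := ler_normD (z x - y N x) (y N x - y N t).
  have := ler_normD (z x - y N x + (y N x - y N t)) (y N t - z t).
  rewrite (distrC (y N t) (z t)); lra.
exists z => // x; apply/eqP; rewrite -subr_eq0 -normr_le0; apply/ler_addgt0Pr => e e0.
have e2 : 0 < e / 2 by rewrite divr_gt0.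
have [N HN] := small _ e2.
have := ctr z (y N) _ cz (cy N) (zy N) x.
have := zy N.+1 x; have := HN N (leqnn N); have := HN N.+1 (leqnSn N).
have := ler_normD (Phi z x - y N.+1 x) (y N.+1 x - z x).
rewrite addrA subrK (distrC (y N.+1 x)) add0r => h1 h2 h3 h4.
rewrite -[Phi (y N) x]/(y N.+1 x); lra.
Qed.

End Primitive.

(** * Existence of solutions at large frequency *)

Section Oscillator.
Context {R : realType}.
Implicit Types (p A B : R -> R) (k L Q : R).

(* Amplitudes of a solution y of y'' = (p - k^2) y, in the form
   y = A cos(k x) + B sin(k x), y' / k = - A sin(k x) + B cos(k x). *)
Definition oscy k A B (x : R) := A x * cos (k * x) + B x * sin (k * x).
Definition oscw k A B (x : R) := - A x * sin (k * x) + B x * cos (k * x).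

Lemma oscy_le k A B (x : R) : `|oscy k A B x| <= `|A x| + `|B x|.
Proof.
apply: (le_trans (ler_normD _ _)); rewrite !normrM lerD// ler_piMr//.
  by rewrite ler_norml cos_geN1 cos_le1.
by rewrite ler_norml sin_geN1 sin_le1.
Qed.

(** Variation of parameters: this system expresses y' = k w and w' = (p / k - k) y. The factor 1/k
    on the right keeps A and B nearly constant when k is large. *)
Definition osc p k L A B := forall x : R, 0 <= x <= L ->
  is_derive x 1 A (- (k^-1 * p x * oscy k A B x * sin (k * x))) /\
  is_derive x 1 B (k^-1 * p x * oscy k A B x * cos (k * x)).

(** Picard iteration in a single step: for large k the factor 1/k makes the integral operator a
    contraction on the whole interval. *)
Lemma osc_exists p k L Q (A0 B0 : R) : continuous p -> (forall x, `|p x| <= Q) ->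
  0 < L -> 0 < k -> 4 * Q * (L + 1) <= k ->
  exists A B, [/\ A 0 = A0, B 0 = B0 & osc p k L A B].
Proof.
move=> cp pQ L0 k0 kQ.
have Q0 : 0 <= Q by apply: le_trans (pQ 0).
have [Pr HPr] : {Pr : (R -> R) -> R -> R & forall h, continuous h ->
    Pr h 0 = 0 /\ forall x : R, is_derive x 1 (Pr h) (h x)}.
  apply: (choice (P := fun h (H : R -> R) => continuous h ->
    H 0 = 0 /\ forall x : R, is_derive x 1 H (h x))) => h.
  have [ch|nch] := pselect (continuous h); last by exists h.
  by have [H HH] := continuous_primitive ch; exists H.
have cPr h : continuous h -> continuous (Pr h).
  move=> ch x; have [_ /(_ x)[dx _]] := HPr h ch.
  by apply: differentiable_continuous; apply/derivable1_diffP.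
have PB (H g : R -> R) M : H 0 = 0 -> (forall z : R, is_derive z 1 H (g z)) ->
    (forall z, `|g z| <= M) -> forall x, `|H x| <= M * `|x|.
  move=> H0 dH gM x; have [x0|x0] := leP 0 x.
    have := derive_le_lipschitz x0 (fun z _ => dH z) (fun z _ => gM z).
    by rewrite H0 !subr0 (ger0_norm x0).
  have := derive_le_lipschitz (ltW x0) (fun z _ => dH z) (fun z _ => gM z).
  by rewrite H0 !sub0r normrN (ltr0_norm x0).
have PrB h h' M : continuous h -> continuous h' -> (forall x, `|h x - h' x| <= M) ->
    forall x, `|Pr h x - Pr h' x| <= M * `|x|.
  move=> ch ch' hM; have [h0 dh] := HPr h ch; have [h'0 dh'] := HPr h' ch'.
  by apply: (PB (fun t => Pr h t - Pr h' t) _ _ _ _ hM); rewrite h0 h'0 subrr.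
(* Truncating the argument bounds the primitives uniformly while every function stays continuous on
   the line; on [0, L] nothing changes. *)
pose cl : R -> R := (id \max (fun=> -1)) \min (fun=> L + 1).
have ccl : continuous cl.
  move=> x; apply: continuous_min; last exact: cst_continuous.
  by apply: continuous_max; [by move=> t|exact: cst_continuous].
have clB x : `|cl x| <= L + 1.
  rewrite /cl/= ler_norml.
  by case: (leP x (-1)) => ?; [case: (leP (-1) (L + 1)) => ?|case: (leP x (L + 1)) => ?]; lra.
have clE x : 0 <= x <= L -> cl x = x.
  move=> xL; rewrite /cl/=.
  by case: (leP x (-1)) => ?; [case: (leP (-1) (L + 1)) => ?|case: (leP x (L + 1)) => ?]; lra.
have ccos : continuous (fun x => cos (k * x)).
  move=> x; apply: (@continuous_comp _ _ _ (fun x => k * x) cos).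
    exact: mulrl_continuous.
  exact: continuous_cos.
have csin : continuous (fun x => sin (k * x)).
  move=> x; apply: (@continuous_comp _ _ _ (fun x => k * x) sin).
    exact: mulrl_continuous.
  exact: continuous_sin.
pose hs y x := p x * y x * sin (k * x).
pose hc y x := p x * y x * cos (k * x).
have chs y : continuous y -> continuous (hs y).
  by move=> cy x; apply: cvgM; [apply: cvgM; [exact: cp|exact: cy]|exact: csin].
have chc y : continuous y -> continuous (hc y).
  by move=> cy x; apply: cvgM; [apply: cvgM; [exact: cp|exact: cy]|exact: ccos].
pose AA y x := A0 - k^-1 * Pr (hs y) x.
pose BB y x := B0 + k^-1 * Pr (hc y) x.
(* The fixed point is sought for y alone; the amplitudes are then primitives of expressions in y. *)
pose Phi y x := oscy k (AA y) (BB y) (cl x).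
have [|||y cy yE] := @contraction_fixpoint R Phi (`|A0| + `|B0|).
- move=> y cy x; apply: (@continuous_comp _ _ _ cl (oscy k (AA y) (BB y))).
    exact: ccl.
  rewrite /oscy; apply: cvgD; apply: cvgM; try exact: ccos; try exact: csin.
  + apply: cvgB; first exact: cvg_cst.
    by apply: cvgM; [exact: cvg_cst|apply/cPr/chs].
  + apply: cvgD; first exact: cvg_cst.
    by apply: cvgM; [exact: cvg_cst|apply/cPr/chc].
- move=> x; apply: (le_trans (oscy_le _ _ _ _)).
  have Pr0 (h : R -> R) : h = cst 0 -> Pr h (cl x) = 0.
    move=> h0; apply/eqP; rewrite -normr_le0 -(mul0r `|cl x|).
    have [|P0 dP] := HPr h; first by rewrite h0; exact: cst_continuous.
    by apply: (PB _ _ _ P0 dP) => z; rewrite h0 normr0.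
  rewrite /AA /BB !Pr0 ?mulr0 ?subr0 ?addr0//.
  + by apply/funext => z; rewrite /hc mulr0 mul0r.
  + by apply/funext => z; rewrite /hs mulr0 mul0r.
- move=> y z M cy cz yzM x.
  have -> : Phi y x - Phi z x = oscy k (fun t => AA y t - AA z t) (fun t => BB y t - BB z t) (cl x).
    by rewrite /Phi /oscy; ring.
  apply: (le_trans (oscy_le _ _ _ _)).
  have M0 : 0 <= M by apply: le_trans (yzM 0).
  have hb (g : R -> R) t : `|g t| <= 1 -> `|p t * y t * g t - p t * z t * g t| <= Q * M.
    move=> g1; rewrite -mulrBl -mulrBr normrM -[leRHS]mulr1 ler_pM// normrM ler_pM//.
  have hA : `|AA y (cl x) - AA z (cl x)| <= k^-1 * (Q * M * (L + 1)).
    have -> : AA y (cl x) - AA z (cl x) = k^-1 * (Pr (hs z) (cl x) - Pr (hs y) (cl x)).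
      by rewrite /AA; ring.
    rewrite normrM gtr0_norm ?invr_gt0// ler_pM2l ?invr_gt0//.
    apply: (le_trans (PrB _ _ (Q * M) (chs z cz) (chs y cy) _ (cl x))).
      by move=> t; rewrite distrC; apply: (hb (fun t => sin (k * t))); rewrite ler_norml sin_geN1 sin_le1.
    by rewrite ler_wpM2l// mulr_ge0.
  have hB : `|BB y (cl x) - BB z (cl x)| <= k^-1 * (Q * M * (L + 1)).
    have -> : BB y (cl x) - BB z (cl x) = k^-1 * (Pr (hc y) (cl x) - Pr (hc z) (cl x)).
      by rewrite /BB; ring.
    rewrite normrM gtr0_norm ?invr_gt0// ler_pM2l ?invr_gt0//.
    apply: (le_trans (PrB _ _ (Q * M) (chc y cy) (chc z cz) _ (cl x))).
      by move=> t; apply: (hb (fun t => cos (k * t))); rewrite ler_norml cos_geN1 cos_le1.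
    by rewrite ler_wpM2l// mulr_ge0.
  (* A quarter for each amplitude gives the ratio 1/2; this fixes the threshold 4 * Q * (L + 1) for
     k. *)
  have : k^-1 * (Q * M * (L + 1)) <= M / 4.
    rewrite mulrC ler_pdivrMr//.
    have -> : Q * M * (L + 1) = M / 4 * (4 * Q * (L + 1)) by field.
    by rewrite ler_wpM2l// divr_ge0.
  lra.
exists (AA y), (BB y); split.
- by rewrite /AA (HPr _ (chs y cy)).1 mulr0 subr0.
- by rewrite /BB (HPr _ (chc y cy)).1 mulr0 addr0.
move=> x xL.
have -> : oscy k (AA y) (BB y) x = y x by rewrite -yE /Phi clE.
have [_ /(_ x) ds] := HPr _ (chs y cy); have [_ /(_ x) dc] := HPr _ (chc y cy).
split.
- by rewrite /AA; apply: is_derive_eq; rewrite /hs /GRing.scale/=; ring.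
- by rewrite /BB; apply: is_derive_eq; rewrite /hc /GRing.scale/=; ring.
Qed.

End Oscillator.

(** * Bounds for the amplitudes *)

Section OscillatorEstimates.
Context {R : realType}.
Notation mu := (@lebesgue_measure R).
Implicit Types (p A B : R -> R) (k L Q : R).

Lemma is_derive_within_continuous (L : R) (f df : R -> R) :
  (forall x, 0 <= x <= L -> is_derive x 1 f (df x)) -> {within `[0, L], continuous f}.
Proof.
move=> h; apply: derivable_within_continuous => x; rewrite in_itv/= => xL.
by have [] := h x xL.
Qed.

Lemma within_continuousD (L : R) (f g : R -> R) : {within `[0, L], continuous f} ->
  {within `[0, L], continuous g} -> {within `[0, L], continuous (fun x => f x + g x)}.
Proof. by move=> cf cg x; apply: cvgD; [exact: cf|exact: cg]. Qed.

Lemma within_continuousM (L : R) (f g : R -> R) : {within `[0, L], continuous f} ->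
  {within `[0, L], continuous g} -> {within `[0, L], continuous (fun x => f x * g x)}.
Proof. by move=> cf cg x; apply: cvgM; [exact: cf|exact: cg]. Qed.

Lemma within_continuous_cst (L c : R) : {within `[0, L], continuous (fun _ : R => c)}.
Proof. by move=> x; exact: cvg_cst. Qed.

(** On a short interval Gronwall needs no exponential: if N is the maximum of |u| + |v|, the mean
    value theorem gives N <= |u 0| + |v 0| + 2 L (alpha N + beta), and 2 L alpha <= 1/2 absorbs the
    term in N. *)
Lemma small_gronwall (L alpha beta : R) (u v du dv : R -> R) :
  0 < L -> 0 <= alpha -> 0 <= beta -> 4 * L * alpha <= 1 ->
  (forall x, 0 <= x <= L -> is_derive x 1 u (du x)) ->
  (forall x, 0 <= x <= L -> is_derive x 1 v (dv x)) ->
  (forall x, 0 <= x <= L -> `|du x| <= alpha * (`|u x| + `|v x|) + beta) ->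
  (forall x, 0 <= x <= L -> `|dv x| <= alpha * (`|u x| + `|v x|) + beta) ->
  forall x, 0 <= x <= L -> `|u x| + `|v x| <= 2 * (`|u 0| + `|v 0|) + 4 * L * beta.
Proof.
move=> L0 a0 b0 La Du Dv duB dvB.
have [|c cL cmax] := @EVT_max R (fun x => `|u x| + `|v x|) 0 L (ltW L0).
  apply: within_continuousD => x.
    by apply: cvg_norm; exact: (is_derive_within_continuous Du).
  by apply: cvg_norm; exact: (is_derive_within_continuous Dv).
move: cL; rewrite in_itv/= => /andP[c0 cL].
pose N := `|u c| + `|v c|.
have NB x : 0 <= x <= L -> `|u x| + `|v x| <= N by move=> xL; apply: cmax; rewrite in_itv.
have N0 : 0 <= N by rewrite addr_ge0.
have K x : 0 <= x <= L -> alpha * (`|u x| + `|v x|) + beta <= alpha * N + beta.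
  by move=> xL; rewrite lerD2r ler_wpM2l// NB.
have uc : `|u c - u 0| <= (alpha * N + beta) * (c - 0).
  apply: (@derive_le_lipschitz _ _ du) => // x /andP[x0 xc].
    by apply: Du; rewrite x0 (le_trans xc).
  by apply: (le_trans (duB _ _)); [|apply: K]; rewrite x0 (le_trans xc).
have vc : `|v c - v 0| <= (alpha * N + beta) * (c - 0).
  apply: (@derive_le_lipschitz _ _ dv) => // x /andP[x0 xc].
    by apply: Dv; rewrite x0 (le_trans xc).
  by apply: (le_trans (dvB _ _)); [|apply: K]; rewrite x0 (le_trans xc).
have cc : (alpha * N + beta) * (c - 0) <= (alpha * N + beta) * L.
  by rewrite subr0 ler_wpM2l// addr_ge0// mulr_ge0.
have LaN : 4 * L * alpha * N <= N by rewrite ler_piMl.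
have := lerB_normD (u c) (- u 0); have := lerB_normD (v c) (- v 0).
rewrite !normrN => h1 h2 x /NB h3.
have NE : N = `|u c| + `|v c| by [].
clearbody N; lra.
Qed.

Lemma osc_derive p k L A B x : k != 0 -> osc p k L A B -> 0 <= x <= L ->
  is_derive x 1 (oscy k A B) (k * oscw k A B x) /\
  is_derive x 1 (oscw k A B) (k^-1 * p x * oscy k A B x - k * oscy k A B x).
Proof.
move=> k0 H xL; have [dA dB] := H x xL.
have dc : is_derive x 1 (fun t => cos (k * t)) (- k * sin (k * x)).
  have := is_derive_cos_affine k 0 x; rewrite addr0.
  by under [in X in X -> _]eq_fun do rewrite addr0.
have ds : is_derive x 1 (fun t => sin (k * t)) (k * cos (k * x)).
  have := is_derive_sin_affine k 0 x; rewrite addr0.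
  by under [in X in X -> _]eq_fun do rewrite addr0.
split.
  rewrite /oscy; apply: is_derive_eq; rewrite /GRing.scale/= /oscw /oscy.
  ring.
rewrite /oscw; apply: is_derive_eq; rewrite /GRing.scale/=.
set y := oscy k A B x.
have -> : k * y = k * (A x * cos (k * x) + B x * sin (k * x)) by [].
have E := cos2Dsin2 (k * x).
transitivity (k^-1 * p x * y * (cos (k * x) ^+ 2 + sin (k * x) ^+ 2) -
  k * (A x * cos (k * x) + B x * sin (k * x))); first ring.
by rewrite E mulr1.
Qed.

Lemma oscw_le k A B (x : R) : `|oscw k A B x| <= `|A x| + `|B x|.
Proof.
apply: (le_trans (ler_normD _ _)); rewrite !normrM normrN lerD// ler_piMr//.
  by rewrite ler_norml sin_geN1 sin_le1.
by rewrite ler_norml cos_geN1 cos_le1.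
Qed.

Lemma osc_derive_le p k Q A B x : 0 < k -> (forall x, `|p x| <= Q) ->
  `|k^-1 * p x * oscy k A B x| <= Q / k * (`|A x| + `|B x|).
Proof.
move=> k0 pQ; rewrite !normrM ler_pM ?mulr_ge0 ?oscy_le//.
by rewrite mulrC ler_pM// gtr0_norm// invr_gt0.
Qed.

Lemma osc_bound p k L Q A B : 0 < k -> 0 < L -> (forall x, `|p x| <= Q) ->
  4 * L * Q <= k -> osc p k L A B ->
  forall x, 0 <= x <= L -> `|A x| + `|B x| <= 2 * (`|A 0| + `|B 0|).
Proof.
move=> k0 L0 pQ kQ H x xL.
have Q0 : 0 <= Q by apply: le_trans (pQ 0).
have t1 (t z : R) : `|t| <= 1 -> `|z * t| <= `|z|.
  by move=> ?; rewrite normrM ler_piMr.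
have := @small_gronwall L (Q / k) 0 A B
  (fun x => - (k^-1 * p x * oscy k A B x * sin (k * x)))
  (fun x => k^-1 * p x * oscy k A B x * cos (k * x)) L0 _ (lexx 0) _ _ _ _ _ x xL.
rewrite mulr0 addr0; apply.
- by rewrite divr_ge0// ltW.
- by rewrite mulrA ler_pdivrMr// mul1r.
- by move=> z /H[].
- by move=> z /H[].
- move=> z _; rewrite normrN addr0; apply: (le_trans (t1 _ _ _)).
    by rewrite ler_norml sin_geN1 sin_le1.
  exact: osc_derive_le.
- move=> z _; rewrite addr0; apply: (le_trans (t1 _ _ _)).
    by rewrite ler_norml cos_geN1 cos_le1.
  exact: osc_derive_le.
Qed.

Lemma osc_amplitude_near p k L Q A B : 0 < k -> 0 < L -> (forall x, `|p x| <= Q) ->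
  4 * L * Q <= k -> osc p k L A B ->
  forall x, 0 <= x <= L ->
    `|A x - A 0| <= 2 * L * Q / k * (`|A 0| + `|B 0|) /\
    `|B x - B 0| <= 2 * L * Q / k * (`|A 0| + `|B 0|).
Proof.
move=> k0 L0 pQ kQ H x xL.
have Q0 : 0 <= Q by apply: le_trans (pQ 0).
have bd := osc_bound k0 L0 pQ kQ H.
have t1 (t z : R) : `|t| <= 1 -> `|z * t| <= `|z|.
  by move=> ?; rewrite normrM ler_piMr.
have dbd z : 0 <= z <= x ->
    `|k^-1 * p z * oscy k A B z| <= Q / k * (2 * (`|A 0| + `|B 0|)).
  move=> zx; apply: (le_trans (osc_derive_le _ _ _ k0 pQ)) => //.
  by rewrite ler_wpM2l ?divr_ge0 ?(ltW k0)//; apply: bd; lra.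
have x0 : 0 <= x by lra.
have fin (z : R) : z <= Q / k * (2 * (`|A 0| + `|B 0|)) * (x - 0) ->
    z <= 2 * L * Q / k * (`|A 0| + `|B 0|).
  move=> /le_trans; apply.
  have -> : 2 * L * Q / k * (`|A 0| + `|B 0|) = Q / k * (2 * (`|A 0| + `|B 0|)) * L by ring.
  by rewrite ler_wpM2l ?mulr_ge0 ?invr_ge0 ?addr_ge0 ?(ltW k0)//; lra.
split; apply: fin.
- apply: (@derive_le_lipschitz _ _ (fun x => - (k^-1 * p x * oscy k A B x * sin (k * x)))) => //.
    by move=> z zx; have [|//] := H z; lra.
  move=> z zx; rewrite normrN; apply: (le_trans (t1 _ _ _)); last exact: dbd.
  by rewrite ler_norml sin_geN1 sin_le1.
- apply: (@derive_le_lipschitz _ _ (fun x => k^-1 * p x * oscy k A B x * cos (k * x))) => //.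
    by move=> z zx; have [|//] := H z; lra.
  move=> z zx; apply: (le_trans (t1 _ _ _)); last exact: dbd.
  by rewrite ler_norml cos_geN1 cos_le1.
Qed.

End OscillatorEstimates.

(** * Dependence on the frequency, Wronskian and Green identities *)

Section OscillatorFamily.
Context {R : realType}.
Notation mu := (@lebesgue_measure R).
Implicit Types (p A B : R -> R) (k L Q : R).

Lemma oscB k A B A' B' (x : R) :
  oscy k A B x - oscy k A' B' x = oscy k (fun t => A t - A' t) (fun t => B t - B' t) x.
Proof. rewrite /oscy; ring. Qed.

Lemma trig_scaled_lipschitz (k k' x L : R) (g : R -> R) : 1 <= k -> 1 <= k' -> 0 <= x <= L ->
  (forall s t, `|g s - g t| <= `|s - t|) -> (forall s, `|g s| <= 1) ->
  `|k^-1 * g (k * x) - k'^-1 * g (k' * x)| <= (L + 1) * `|k - k'|.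
Proof.
move=> k1 k'1 xL gl g1.
have -> : k^-1 * g (k * x) - k'^-1 * g (k' * x) =
  k^-1 * (g (k * x) - g (k' * x)) + (k^-1 - k'^-1) * g (k' * x) by ring.
apply: (le_trans (ler_normD _ _)); rewrite [leRHS]mulrDl [1 * _]mul1r lerD//.
- rewrite normrM mulrC; apply: le_trans (_ : `|g (k * x) - g (k' * x)| * 1 <= _).
    by rewrite ler_wpM2l// ger0_norm ?invr_ge0 ?invf_le1 //; lra.
  rewrite mulr1; apply: (le_trans (gl _ _)).
  rewrite -mulrBl normrM mulrC ler_wpM2r// ger0_norm; lra.
- rewrite normrM; apply: le_trans (_ : `|k^-1 - k'^-1| * 1 <= _).
    by rewrite ler_wpM2l.
  have -> : k^-1 - k'^-1 = (k' - k) * (k * k')^-1.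
    by field; rewrite !gt_eqF//; lra.
  rewrite mulr1 normrM distrC ler_piMr// ger0_norm ?invr_ge0 ?invf_le1 //; nra.
Qed.

(** This yields continuity in k of the endpoint data, as the intermediate value argument requires.
    The differences of amplitudes start at 0 and satisfy the hypothesis of [small_gronwall] with
    [beta] proportional to |k - k'|. *)
Lemma osc_lipschitz p L Q k k' A B A' B' (N : R) : 0 < L -> (forall x, `|p x| <= Q) ->
  1 <= k -> 1 <= k' -> 4 * L * Q <= k -> 4 * L * Q <= k' ->
  osc p k L A B -> osc p k' L A' B' -> A 0 = A' 0 -> B 0 = B' 0 ->
  `|A' 0| + `|B' 0| <= N ->
  forall x, 0 <= x <= L -> `|A x - A' x| + `|B x - B' x| <=
    4 * L * (Q * (2 * N) * (2 * L + 1)) * `|k - k'|.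
Proof.
move=> L0 pQ k1 k'1 kQ k'Q H H' AA BB N0N x xL.
have Q0 : 0 <= Q by apply: le_trans (pQ 0).
have k0 : 0 < k by lra.
have k'0 : 0 < k' by lra.
have N0 : 0 <= N by apply: le_trans N0N; rewrite addr_ge0.
have bd z : 0 <= z <= L -> `|A' z| + `|B' z| <= 2 * N.
  by move=> zL; have := osc_bound k'0 L0 pQ k'Q H' zL; lra.
have s1 (t : R) : `|sin t| <= 1 by rewrite ler_norml sin_geN1 sin_le1.
have c1 (t : R) : `|cos t| <= 1 by rewrite ler_norml cos_geN1 cos_le1.
have main (g : R -> R) z : 0 <= z <= L -> (forall s t, `|g s - g t| <= `|s - t|) -> (forall s, `|g s| <= 1) ->
  `|k^-1 * p z * oscy k A B z * g (k * z) - k'^-1 * p z * oscy k' A' B' z * g (k' * z)| <=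
   Q / k * (`|A z - A' z| + `|B z - B' z|) + Q * (2 * N) * (2 * L + 1) * `|k - k'|.
  move=> zL gl g1.
  (* Telescoping: change the amplitudes, then the frequency inside [oscy], then the frequency in the
     outer factor. *)
  have -> : k^-1 * p z * oscy k A B z * g (k * z) - k'^-1 * p z * oscy k' A' B' z * g (k' * z) =
    p z * (k^-1 * (oscy k A B z - oscy k A' B' z) * g (k * z) +
     (k^-1 * (oscy k A' B' z - oscy k' A' B' z) * g (k * z) +
     oscy k' A' B' z * (k^-1 * g (k * z) - k'^-1 * g (k' * z)))) by ring.
  have kV : `|k^-1| = k^-1 by rewrite gtr0_norm// invr_gt0.
  have kV1 : k^-1 <= 1 by rewrite invf_le1.
  have -> : Q / k * (`|A z - A' z| + `|B z - B' z|) + Q * (2 * N) * (2 * L + 1) * `|k - k'| =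
   Q * (k^-1 * (`|A z - A' z| + `|B z - B' z|) * 1 +
     (1 * (2 * N * (L * `|k - k'|)) * 1 + 2 * N * ((L + 1) * `|k - k'|))) by ring.
  rewrite normrM ler_pM// (le_trans (ler_normD _ _))// lerD//.
    by rewrite !normrM kV ler_pM ?mulr_ge0 ?invr_ge0 ?(ltW k0)// ler_wpM2l ?invr_ge0 ?(ltW k0)// oscB oscy_le.
  rewrite (le_trans (ler_normD _ _))// lerD//.
    rewrite !normrM kV ler_pM ?mulr_ge0 ?invr_ge0 ?(ltW k0)// ler_pM ?invr_ge0 ?(ltW k0)//.
    have -> : oscy k A' B' z - oscy k' A' B' z =
      A' z * (cos (k * z) - cos (k' * z)) + B' z * (sin (k * z) - sin (k' * z)).
      by rewrite /oscy; ring.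
    have d : `|k * z - k' * z| <= L * `|k - k'|.
      rewrite -mulrBl normrM mulrC ler_wpM2r// ger0_norm; lra.
    apply: le_trans (_ : (`|A' z| + `|B' z|) * (L * `|k - k'|) <= _); last first.
      by rewrite ler_wpM2r ?bd// mulr_ge0// ltW.
    rewrite mulrDl (le_trans (ler_normD _ _))// !normrM lerD// ler_wpM2l//.
      exact: le_trans (cos_lipschitz _ _) d.
    exact: le_trans (sin_lipschitz _ _) d.
  rewrite normrM ler_pM//; first exact: le_trans (oscy_le _ _ _ _) (bd _ zL).
  exact: trig_scaled_lipschitz.
have -> : 4 * L * (Q * (2 * N) * (2 * L + 1)) * `|k - k'| =
    2 * (`|A 0 - A' 0| + `|B 0 - B' 0|) +
    4 * L * (Q * (2 * N) * (2 * L + 1) * `|k - k'|).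
  by rewrite AA BB !subrr normr0; ring.
apply: (@small_gronwall R L (Q / k) (Q * (2 * N) * (2 * L + 1) * `|k - k'|)
  (fun x => A x - A' x) (fun x => B x - B' x)
  (fun x => - (k^-1 * p x * oscy k A B x * sin (k * x)) -
      - (k'^-1 * p x * oscy k' A' B' x * sin (k' * x)))
  (fun x => k^-1 * p x * oscy k A B x * cos (k * x) -
      k'^-1 * p x * oscy k' A' B' x * cos (k' * x))) => //.
- by rewrite divr_ge0// ltW.
- by rewrite !mulr_ge0//; lra.
- by rewrite mulrA ler_pdivrMr// mul1r.
- by move=> z zL; have [d1 _] := H z zL; have [d2 _] := H' z zL; exact: is_deriveB.
- by move=> z zL; have [_ d1] := H z zL; have [_ d2] := H' z zL; exact: is_deriveB.
- move=> z zL; rewrite -opprD normrN; apply: (main sin) => // s t; exact: sin_lipschitz.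
- move=> z zL; apply: (main cos) => // s t; exact: cos_lipschitz.
Qed.

(** In amplitudes A B' - B A' is the Wronskian divided by k; its derivative vanishes identically. *)
Lemma osc_wronskian p k L A B A' B' : 0 < L -> k != 0 ->
  osc p k L A B -> osc p k L A' B' ->
  A L * B' L - B L * A' L = A 0 * B' 0 - B 0 * A' 0.
Proof.
move=> L0 k0 H H'; apply/eqP; rewrite -subr_eq0 -normr_le0.
rewrite -[leRHS](mul0r (L - 0)).
pose F x := A x * B' x - B x * A' x; rewrite -/(F L) -/(F 0).
apply: (@derive_le_lipschitz _ _ (fun=> 0)) => //; [exact: ltW| |by move=> *; rewrite normr0].
move=> z zL; have [dA dB] := H z zL; have [dA' dB'] := H' z zL.
rewrite /F; apply: is_derive_eq; rewrite /GRing.scale/= /oscy; ring.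
Qed.

Lemma ip2_ftc (L : R) (f g Y : R -> R) : 0 < L ->
  {within `[0, L], continuous f} -> {within `[0, L], continuous g} ->
  (forall x, 0 <= x <= L -> is_derive x 1 Y (f x * g x)) ->
  ip2 L f g = Y L - Y 0.
Proof.
move=> L0 cf cg dY.
have cfg : {within `[0, L], continuous (fun x => f x * g x)}.
  exact: within_continuousM.
have cY := is_derive_within_continuous dY.
have I : mu.-integrable `[0, L] (EFin \o (fun x => f x * g x)).
  by apply: continuous_compact_integrable => //; exact: segment_compact.
have -> : ip2 L f g = \int[mu]_(x in `[0, L]) (f x * g x).
  rewrite /ip2 Rintegral_itv_bndo_bndc; last exact: (integrable_itvoo_continuous cfg).
  rewrite Rintegral_itv_obnd_cbnd//; apply: integrableS I => //.
  exact: subset_itv_oc_cc.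
rewrite /Rintegral (@continuous_FTC2 _ _ Y)//.
  have /(continuous_within_itvP _ L0)[_ cY0 cYL] := cY.
  split => // x; rewrite in_itv/= => /andP[x0 xL].
  by have [] := dY x; rewrite ?ltW.
move=> x; rewrite in_itv/= => /andP[x0 xL].
have xL' : 0 <= x <= L by rewrite !ltW.
by have [_ <-] := dY x xL'; rewrite derive1E.
Qed.

Lemma osc_within_continuous p k L A B : k != 0 -> osc p k L A B ->
  {within `[0, L], continuous (oscy k A B)} /\ {within `[0, L], continuous (oscw k A B)}.
Proof.
move=> k0 H; split.
  by apply: is_derive_within_continuous => x /(osc_derive k0 H)[d _]; exact: d.
by apply: is_derive_within_continuous => x /(osc_derive k0 H)[_ d]; exact: d.
Qed.

(** Lagrange's identity: the terms in p cancel in the derivative of F, the potential being common to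
    both frequencies. *)
Lemma osc_green p k k' L A B A' B' : 0 < L -> k != 0 -> k' != 0 ->
  osc p k L A B -> osc p k' L A' B' ->
  let F x := k' * oscw k' A' B' x * oscy k A B x - k * oscw k A B x * oscy k' A' B' x in
  (k ^+ 2 - k' ^+ 2) * ip2 L (oscy k A B) (oscy k' A' B') = F L - F 0.
Proof.
move=> L0 k0 k'0 H H' F.
have [cy _] := osc_within_continuous k0 H; have [cy' _] := osc_within_continuous k'0 H'.
rewrite -(@ip2Zr _ L _ _ _ (fun x => (k ^+ 2 - k' ^+ 2) * oscy k' A' B' x))//; last 2 first.
- exact: L2_continuous.
- exact: L2_continuous.
apply: ip2_ftc => //.
  by apply: within_continuousM => //; exact: within_continuous_cst.
move=> x xL; have [d1 d2] := osc_derive k0 H xL; have [d3 d4] := osc_derive k'0 H' xL.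
rewrite /F; apply: is_derive_eq; rewrite /GRing.scale/=; field; exact/andP.
Qed.

End OscillatorFamily.

Section OscillatorLower.
Context {R : realType}.
Notation mu := (@lebesgue_measure R).
Implicit Types (p A B : R -> R) (k L Q : R).

Lemma sqr_normD_le (x y : R) : (`|x| + `|y|) ^+ 2 <= 2 * (x ^+ 2 + y ^+ 2).
Proof.
rewrite -(real_normK (num_real x)) -(real_normK (num_real y)).
by have := sqr_ge0 (`|x| - `|y|); nra.
Qed.

(** Equipartition: (y w)' + 2 k y^2 = k (A^2 + B^2) + p y^2 / k. After integration the boundary term
    y w and the term in p are negligible against k L, so y carries a fixed share of the initial
    amplitude. *)
Lemma osc_ip2_lower p k L Q A B : 0 < L -> continuous p -> (forall x, `|p x| <= Q) ->
  1 <= k -> 8 * L * Q <= k -> 64 * L * Q + 128 <= L * k -> osc p k L A B ->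
  L / 16 * (A 0 ^+ 2 + B 0 ^+ 2) <= ip2 L (oscy k A B) (oscy k A B).
Proof.
move=> L0 cp pQ k1 kQ kL H.
have Q0 : 0 <= Q by apply: le_trans (pQ 0).
have k0 : 0 < k by lra.
have LQ0 : 0 <= L * Q by rewrite mulr_ge0// ltW.
have kn0 : k != 0 by rewrite gt_eqF.
have kQ4 : 4 * L * Q <= k by lra.
pose y := oscy k A B; pose w := oscw k A B.
have [cy cw] := osc_within_continuous kn0 H.
pose N := `|A 0| + `|B 0|; pose S := A 0 ^+ 2 + B 0 ^+ 2.
have NS : N ^+ 2 <= 2 * S by exact: sqr_normD_le.
have N0 : 0 <= N by rewrite addr_ge0.
have S0 : 0 <= S by rewrite addr_ge0 ?sqr_ge0.
have bd x : 0 <= x <= L -> `|A x| + `|B x| <= 2 * N by exact: osc_bound kQ4 H x.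
have yB x : 0 <= x <= L -> `|y x| <= 2 * N.
  by move=> /bd; apply: le_trans; exact: oscy_le.
have wB x : 0 <= x <= L -> `|w x| <= 2 * N.
  by move=> /bd; apply: le_trans; exact: oscw_le.
(* D is the derivative of y * w. *)
pose D x := w x * (k * w x) + y x * (k^-1 * p x * y x + (- k) * y x).
have cD : {within `[0, L], continuous D}.
  have cst := @within_continuous_cst R L.
  apply: within_continuousD.
    apply: within_continuousM; first exact: cw.
    by apply: within_continuousM; [exact: cst|exact: cw].
  apply: within_continuousM; first exact: cy.
  apply: within_continuousD; last by apply: within_continuousM; [exact: cst|exact: cy].
  apply: within_continuousM; last exact: cy.
  by apply: within_continuousM; [exact: cst|exact: continuous_subspaceT].
have ID : ip2 L (fun _ => 1) D = y L * w L - y 0 * w 0.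
  apply: (@ip2_ftc _ L (fun _ => 1) D (fun x => y x * w x)) => //.
    exact: within_continuous_cst.
  move=> x xL; have [dy dw] := osc_derive kn0 H xL.
  by rewrite /y /w; apply: is_derive_eq; rewrite /GRing.scale/= /D /y /w; ring.
have yw x : 0 <= x <= L -> `|y x * w x| <= 8 * S.
  move=> xL; rewrite normrM; have := ler_pM (normr_ge0 _) (normr_ge0 _) (yB x xL) (wB x xL).
  by rewrite expr2 in NS; lra.
have cyy : {within `[0, L], continuous (fun x => 2 * k * (y x * y x))}.
  by apply: within_continuousM; [exact: within_continuous_cst|exact: within_continuousM].
have I2 : ip2 L (fun _ => 1) (fun x => 2 * k * (y x * y x)) = 2 * k * ip2 L y y.
  rewrite /ip2 -RintegralZl//; last first.
    by apply: L2_integrableM; apply: L2_continuous.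
  by apply: eq_Rintegral => x _; rewrite mul1r.
have IS := @ip2Dr _ L (fun _ => 1) _ _ (L2_cst L 1) (L2_continuous cyy) (L2_continuous cD).
(* Each amplitude moves by at most N / 4, hence its square displacement is at most S / 8 and A^2 +
   B^2 stays above S / 4; the term in p uses y^2 <= 8 S. *)
have low x : 0 <= x <= L -> S * (k / 4 - 8 * Q / k) <= 2 * k * (y x * y x) + D x.
  move=> xL.
  have [hA hB] := osc_amplitude_near k0 L0 pQ kQ4 H xL.
  have dlt : 2 * L * Q / k * N <= 4^-1 * N.
    by rewrite ler_wpM2r// ler_pdivrMr//; lra.
  have {}hA := le_trans hA dlt; have {}hB := le_trans hB dlt.
  have sq4 (t : R) : `|t| <= 4^-1 * N -> t ^+ 2 <= S / 8.
    move=> ht; have : `|t| ^+ 2 <= (4^-1 * N) ^+ 2 by rewrite ler_sqr ?nnegrE// mulr_ge0.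
    by rewrite real_normK ?num_real// exprMn; lra.
  have {}hA := sq4 _ hA; have {}hB := sq4 _ hB.
  have AB : S / 4 <= A x ^+ 2 + B x ^+ 2.
    have := sqr_ge0 (2 * A x - A 0); have := sqr_ge0 (2 * B x - B 0).
    rewrite /S in hA hB *; nra.
  have E : 2 * k * (y x * y x) + D x = k * (A x ^+ 2 + B x ^+ 2) + k^-1 * (p x * y x ^+ 2).
    transitivity (k * ((A x ^+ 2 + B x ^+ 2) * (cos (k * x) ^+ 2 + sin (k * x) ^+ 2)) + k^-1 * (p x * y x ^+ 2)).
      by rewrite /D /y /w /oscy /oscw; ring.
    by rewrite cos2Dsin2 mulr1.
  have py : - (Q * (8 * S)) <= p x * y x ^+ 2.
    have : `|p x * y x ^+ 2| <= Q * (8 * S).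
      rewrite normrM ler_pM// normrX.
      apply: le_trans (_ : (2 * N) ^+ 2 <= _).
        by rewrite ler_sqr ?nnegrE ?mulr_ge0// yB.
      by rewrite exprMn; lra.
    by rewrite ler_norml => /andP[].
  rewrite E.
  have h1 : k * (S / 4) <= k * (A x ^+ 2 + B x ^+ 2) by rewrite ler_pM2l.
  have h2 : k^-1 * - (Q * (8 * S)) <= k^-1 * (p x * y x ^+ 2) by rewrite ler_pM2l ?invr_gt0.
  lra.
have Isum : L * (S * (k / 4 - 8 * Q / k)) <= 2 * k * ip2 L y y + (y L * w L - y 0 * w 0).
  rewrite -I2 -ID -IS.
  have -> : L * (S * (k / 4 - 8 * Q / k)) = \int[mu]_(x in `]0, L[) (S * (k / 4 - 8 * Q / k)).
    have muL : fine (mu `]0, L[) = L by rewrite lebesgue_measure_itv/= lte_fin L0/= subr0.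
    by rewrite Rintegral_cst// -[X in X * _ = _]muL mulrC.
  apply: le_Rintegral => //.
  - exact: L2_integrable (L2_cst L _).
  - apply: L2_integrableM; first exact: L2_cst.
    by apply: L2_continuous; exact: within_continuousD.
  - move=> x; rewrite /= in_itv/= => /andP[x0 xL]; rewrite mul1r; apply: low.
    by rewrite !ltW.
have ywL := yw L; have yw0 := yw 0.
have {ywL} ywL : y L * w L - y 0 * w 0 <= 16 * S.
  have LL : 0 <= L <= L by rewrite lexx ltW.
  have LL0 : 0 <= (0 : R) <= L by rewrite lexx ltW.
  move: (ywL LL) (yw0 LL0).
  by rewrite !ler_norml => /andP[? ?] /andP[? ?]; lra.
rewrite -/y -/S -(ler_pM2l (_ : 0 < 2 * k)); last by lra.
have QK : Q / k <= Q by rewrite ler_pdivrMr// ler_peMr.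
have h3 : 0 <= S * (L * k - 64 * L * Q - 128) by rewrite mulr_ge0//; lra.
have h4 : S * L * (Q / k) <= S * L * Q by rewrite ler_wpM2l// mulr_ge0// ltW.
lra.
Qed.

(** Choice turns the solutions into functions of k with initial amplitudes independent of k, so that
    continuity in k can be discussed. *)
Lemma osc_family p L Q (A0 B0 : R) : 0 < L -> continuous p -> (forall x, `|p x| <= Q) ->
  exists A B : R -> R -> R, forall k, 1 + 4 * Q * (L + 1) <= k ->
    [/\ A k 0 = A0, B k 0 = B0 & osc p k L (A k) (B k)].
Proof.
move=> L0 cp pQ.
have Q0 : 0 <= Q by apply: le_trans (pQ 0).
have [F HF] : {F : R -> (R -> R) * (R -> R) & forall k, 1 + 4 * Q * (L + 1) <= k ->
    [/\ (F k).1 0 = A0, (F k).2 0 = B0 & osc p k L (F k).1 (F k).2]}.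
  apply: (choice (P := fun k F => 1 + 4 * Q * (L + 1) <= k ->
    [/\ F.1 0 = A0, F.2 0 = B0 & osc p k L F.1 F.2])) => k.
  have [kQ|] := leP (1 + 4 * Q * (L + 1)) k; last by exists (id, id).
  have [||A [B H]] := @osc_exists R p k L Q A0 B0 cp pQ L0.
  - by have : 0 <= 4 * Q * (L + 1) by [rewrite !mulr_ge0//; lra]; lra.
  - lra.
  by exists (A, B).
by exists (fun k => (F k).1), (fun k => (F k).2).
Qed.

End OscillatorLower.

(** * Two nearby eigenvalues *)

Section Pencil.
Context {R : realType}.
Implicit Types (al be ga : R -> R).

Lemma sym2_kernel (A B C : R) : A * C = B ^+ 2 ->
  exists v s, [/\ A * v + B * s = 0, B * v + C * s = 0 & (v, s) <> (0, 0)].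
Proof.
move=> AC; have [/andP[/eqP A0 /eqP B0]|AB] := boolP ((A == 0) && (B == 0)).
  exists 1, 0; rewrite A0 B0 !mul0r !mulr0 addr0; split => // -[/eqP].
  by rewrite oner_eq0.
exists B, (- A); split; [ring| |].
  by rewrite mulrN [C * A]mulrC AC expr2 subrr.
by move=> -[B0 /eqP]; rewrite oppr_eq0 => A0; rewrite A0 B0 eqxx in AB.
Qed.

Lemma IVT_sign (f : R -> R) (x0 x1 : R) : x0 <= x1 -> {within `[x0, x1], continuous f} ->
  f x0 < 0 -> 0 < f x1 -> exists2 k, x0 <= k <= x1 & f k = 0.
Proof.
move=> x01 cf f0 f1; have [|k] := @IVT R f x0 x1 0 x01 cf.
  by rewrite ge_min le_max (ltW f0) (ltW f1) orbT.
by rewrite in_itv/= => kx fk; exists k.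
Qed.

(* Both eigenvalues of the symmetric matrix [al be; be ga] change sign. *)
Lemma sym2_pencil al be ga (x0 x1 : R) : x0 <= x1 ->
  {within `[x0, x1], continuous al} -> {within `[x0, x1], continuous be} ->
  {within `[x0, x1], continuous ga} ->
  al x0 < - `|be x0| -> ga x0 < - `|be x0| ->
  `|be x1| < al x1 -> `|be x1| < ga x1 ->
  let kernel k v s := [/\ al k * v + be k * s = 0, be k * v + ga k * s = 0 &
                          (v, s) <> (0, 0)] in
  (exists k, x0 <= k <= x1 /\ forall v s, (v, s) <> (0, 0) -> kernel k v s) \/
  (exists k k' v s v' s', [/\ x0 <= k <= x1, x0 <= k' <= x1, k != k',
     kernel k v s & kernel k' v' s']).
Proof.
move=> x01 ca cb cg a0 g0 a1 g1 kernel.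
(* The eigenvalues are (al + ga) / 2 - r and (al + ga) / 2 + r. *)
pose r k := Num.sqrt (((al k - ga k) / 2) ^+ 2 + be k ^+ 2).
have r2 k : r k ^+ 2 = ((al k - ga k) / 2) ^+ 2 + be k ^+ 2.
  by rewrite sqr_sqrtr// addr_ge0 ?sqr_ge0.
have rdet k : ((al k + ga k) / 2) ^+ 2 - r k ^+ 2 = al k * ga k - be k ^+ 2.
  by rewrite r2; field.
have r0 k : 0 <= r k by exact: sqrtr_ge0.
have cs : {within `[x0, x1], continuous (fun k => (al k + ga k) / 2)}.
  by move=> k; apply: cvgM; [apply: cvgD; [exact: ca|exact: cg]|exact: cvg_cst].
have cr : {within `[x0, x1], continuous r}.
  have c1 : {within `[x0, x1], continuous (fun k => (al k - ga k) / 2)}.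
    by move=> z; apply: cvgM; [apply: cvgB; [exact: ca|exact: cg]|exact: cvg_cst].
  have c2 : {within `[x0, x1], continuous (fun k => ((al k - ga k) / 2) ^+ 2 + be k ^+ 2)}.
    rewrite (_ : (fun k => _) = fun k => (al k - ga k) / 2 * ((al k - ga k) / 2) + be k * be k).
      by move=> z; apply: cvgD; apply: cvgM; by [exact: c1|exact: cb].
    by apply/funext => z; rewrite !expr2.
  move=> k; apply: cvg_comp; first exact: c2.
  exact: sqrt_continuous.
(* A positive determinant gives both eigenvalues the sign of the trace. *)
have rlt k (t : R) : 0 < t -> be k ^+ 2 < al k * ga k -> t = (al k + ga k) / 2 \/ t = - ((al k + ga k) / 2) -> r k < t.
  move=> t0 bag tE; rewrite -(ltr_pXn2r (n := 2))// ?nnegrE ?r0 ?(ltW t0)//.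
  have -> : t ^+ 2 = ((al k + ga k) / 2) ^+ 2 by case: tE => ->; rewrite ?sqrrN.
  by have := rdet k; lra.
have bb k : be k ^+ 2 = `|be k| * `|be k| by rewrite -expr2 real_normK ?num_real.
have R0 : r x0 < - ((al x0 + ga x0) / 2).
  have n0 := normr_ge0 (be x0); apply: rlt; [lra| |by right].
  by rewrite bb -[ltRHS]mulrNN ltr_pM//; lra.
have R1 : r x1 < (al x1 + ga x1) / 2.
  have n0 := normr_ge0 (be x1); apply: rlt; [lra| |by left].
  by rewrite bb ltr_pM//; lra.
have [k kx kE] : exists2 k, x0 <= k <= x1 & (al k + ga k) / 2 - r k = 0.
  apply: IVT_sign => //; last by rewrite subr_gt0.
    by move=> z; apply: cvgB; [exact: cs|exact: cr].
  by have := r0 x0; have := normr_ge0 (be x0); lra.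
have [k' k'x k'E] : exists2 k, x0 <= k <= x1 & (al k + ga k) / 2 + r k = 0.
  apply: IVT_sign => //.
  - by move=> z; apply: cvgD; [exact: cs|exact: cr].
  - lra.
  - by have := r0 x1; lra.
have [kk|kk] := eqVneq k k'; last first.
  right; have [|v [s K]] := @sym2_kernel (al k) (be k) (ga k).
    have := rdet k; have -> : (al k + ga k) / 2 = r k by lra.
    by rewrite subrr => /esym/eqP; rewrite subr_eq0 => /eqP.
  have [|v' [s' K']] := @sym2_kernel (al k') (be k') (ga k').
    have := rdet k'; have -> : (al k' + ga k') / 2 = - r k' by lra.
    by rewrite sqrrN subrr => /esym/eqP; rewrite subr_eq0 => /eqP.
  by exists k, k', v, s, v', s'.
(* Both eigenvalues vanish at the same k, so the matrix is zero and its kernel is the plane. *)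
left; exists k; split => //; rewrite -kk in k'E.
have rk : r k = 0 by lra.
have ag : al k = - ga k by lra.
have := r2 k; rewrite rk expr0n/= => /esym/eqP.
rewrite paddr_eq0 ?sqr_ge0// !sqrf_eq0 => /andP[/eqP ag2 /eqP be0].
have al0 : al k = 0 by lra.
have ga0 : ga k = 0 by lra.
by move=> v s vs; rewrite /kernel al0 be0 ga0 !mul0r addr0.
Qed.

End Pencil.

(** * The matrix of the vertex conditions *)

Section VertexConditions.
Context {R : realType}.

Lemma cosD_natpi (x : R) n : cos (x + n%:R * pi) = (-1) ^+ n * cos x.
Proof.
elim: n => [|n IH]; first by rewrite mul0r addr0 expr0 mul1r.
by rewrite -natr1 mulrDl mul1r addrA cosDpi IH exprS mulN1r mulNr.
Qed.

Lemma sinD_natpi (x : R) n : sin (x + n%:R * pi) = (-1) ^+ n * sin x.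
Proof.
elim: n => [|n IH]; first by rewrite mul0r addr0 expr0 mul1r.
by rewrite -natr1 mulrDl mul1r addrA sinDpi IH exprS mulN1r mulNr.
Qed.

Lemma normr_cos_le1 (x : R) : `|cos x| <= 1.
Proof. by rewrite ler_norml cos_geN1 cos_le1. Qed.

Lemma normr_sin_le1 (x : R) : `|sin x| <= 1.
Proof. by rewrite ler_norml sin_geN1 sin_le1. Qed.

Lemma cos_ge_small (x : R) : 1 - `|x| <= cos x.
Proof.
by have := cos_lipschitz 0 x; rewrite cos0 subr0 ler_norml => /andP[]; lra.
Qed.

Lemma sin_le_small (x : R) : `|sin x| <= `|x|.
Proof. by have := sin_lipschitz 0 x; rewrite sin0 !subr0. Qed.

Lemma sin_ge_small (h : R) : 0 <= h <= 4^-1 -> 3 / 4 * h <= sin h.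
Proof.
move=> /andP[h0 h4].
have [|z] := @MVT_segment R sin cos 0 h h0.
  by apply: derivable_within_continuous => x _; have [] := is_derive_sin x.
rewrite in_itv/= sin0 !subr0 => /andP[z0 zh] ->; rewrite ler_wpM2r//.
by apply: le_trans (cos_ge_small z); rewrite ger0_norm//; lra.
Qed.

Lemma normrM_near (d x y x0 y0 : R) : 0 <= d <= 1 -> `|x0| <= 1 -> `|y0| <= 1 ->
  `|x - x0| <= d -> `|y - y0| <= d -> `|x * y - x0 * y0| <= 3 * d.
Proof.
move=> /andP[d0 d1] hx0 hy0 hx hy.
have -> : x * y - x0 * y0 = (x - x0) * (y - y0) + ((x - x0) * y0 + x0 * (y - y0)) by ring.
have h1 : `|(x - x0) * (y - y0)| <= d * 1.
  by rewrite normrM ler_pM// (le_trans hy).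
have h2 : `|(x - x0) * y0| <= d * 1 by rewrite normrM ler_pM.
have h3 : `|x0 * (y - y0)| <= 1 * d by rewrite normrM ler_pM.
have := ler_normD ((x - x0) * (y - y0)) ((x - x0) * y0 + x0 * (y - y0)).
have := ler_normD ((x - x0) * y0) (x0 * (y - y0)); lra.
Qed.

(** The diagonal entries are of first order in x, the off-diagonal one of second order, and d is the
    error due to the potential. With sx >= 3/4 * x >= 45 * d the final margin 5/8 * sx - 21 * d is
    positive. *)
Lemma dominance (d x sx cx D E G u X : R) : 0 <= d -> 60 * d <= x -> 0 < x -> 8 * x <= 1 ->
  3 / 4 * x <= sx -> sx <= x -> 7 / 8 <= cx -> cx <= 1 -> 1 / 2 <= X <= 9 / 8 ->
  `|D - (1 - 2 * (sx * sx))| <= 6 * d -> E <= - (2 * (sx * cx)) + 6 * d ->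
  2 * (sx * cx) - 6 * d <= G -> - (3 * d) <= u -> 1 / 2 <= D <= 2 ->
  `|1 - D| * X < u * D - E * (X * X) /\ `|1 - D| * X < G.
Proof.
move=> d0 dx x0 x8 sx1 sx2 cx1 cx2 /andP[X1 X2] hD hE hG hu /andP[D1 D2].
have sc : 7 / 8 * sx <= sx * cx by rewrite mulrC ler_wpM2l//; lra.
have ss : sx * sx <= sx / 8 by rewrite ler_wpM2l//; lra.
have ss0 : 0 <= sx * sx by rewrite mulr_ge0//; lra.
have B : `|1 - D| <= sx / 4 + 6 * d.
  by move: hD; rewrite !ler_norml => /andP[? ?]; apply/andP; split; lra.
have BX : `|1 - D| * X <= (sx / 4 + 6 * d) * X by rewrite ler_wpM2r//; lra.
have uD : 0 <= (u + 3 * d) * D by rewrite mulr_ge0; lra.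
have dD : d * D <= d * 2 by rewrite ler_wpM2l.
have EX : (7 / 4 * sx - 6 * d) * (X * X) <= - E * (X * X).
  by rewrite ler_wpM2r ?mulr_ge0//; lra.
have XX : (7 / 4 * sx - 6 * d) * X * (1 / 2) <= (7 / 4 * sx - 6 * d) * X * X.
  by rewrite ler_wpM2l// mulr_ge0//; lra.
have key : 0 < (5 / 8 * sx - 21 * d) * X by rewrite mulr_gt0//; lra.
have dX : d * (1 / 2) <= d * X by rewrite ler_wpM2l.
have sX : sx * X <= sx * (9 / 8) by rewrite ler_wpM2l//; lra.
have dX' : d * X <= d * (9 / 8) by rewrite ler_wpM2l.
split; lra.
Qed.

Lemma dominance_trig (h d z D E G c c' : R) : 0 <= d -> 60 * d <= h -> 0 < h -> 8 * h <= 1 ->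
  0 <= z <= 4^-1 -> `|D - (1 - 2 * (sin h * sin h))| <= 6 * d ->
  `|E - - (2 * (sin h * cos h))| <= 6 * d -> `|G - 2 * (sin h * cos h)| <= 6 * d ->
  `|c' * c + sin z * cos z| <= 3 * d -> 1 / 2 <= `|c| <= 9 / 8 -> 1 / 2 <= D <= 2 ->
  `|(1 - D) * c| < - (c' * c) * D - E * (c * c) /\ `|(1 - D) * c| < G.
Proof.
move=> d0 dh h0 h8 z0 hD hE hG hu hc D0.
have h4 : 0 <= h <= 4^-1 by clear -h0 h8; lra.
have sge := sin_ge_small h4.
have sle : sin h <= h.
  by apply: (le_trans (ler_norm _)); rewrite (le_trans (sin_le_small _))// gtr0_norm.
have cge : 7 / 8 <= cos h.
  by apply: le_trans (cos_ge_small _); rewrite gtr0_norm//; clear -h8; lra.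
have zz : 0 <= sin z * cos z.
  have s0 := sin_ge_small z0; have c0 := cos_ge_small z.
  have z1 : `|z| <= 4^-1 by rewrite ger0_norm; clear -z0; lra.
  by rewrite mulr_ge0//; clear -s0 c0 z0 z1; lra.
have -> : c * c = `|c| * `|c| by rewrite -normrM ger0_norm// -expr2 sqr_ge0.
rewrite normrM; apply: (@dominance d h (sin h) (cos h)) => //.
- by move: hE; rewrite ler_norml => /andP[_]; clear; lra.
- by move: hG; rewrite ler_norml => /andP[+ _]; clear; lra.
- by move: hu; rewrite ler_norml => /andP[_]; clear -zz; lra.
Qed.

(** The unperturbed values are cos 2ka, - sin 2ka and sin 2ka, by the addition formulas on the two
    halves of the ring. *)
Lemma vertex_entries_near (d S C c2 c2' s2 s2' c3 c3' s3 s3' : R) :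
  0 <= d <= 1 -> `|S| <= 1 -> `|C| <= 1 -> C * C + S * S = 1 ->
  `|c2 - C| <= d -> `|c2' - - S| <= d -> `|s2 - S| <= d -> `|s2' - C| <= d ->
  `|c3 - C| <= d -> `|c3' - - S| <= d -> `|s3 - S| <= d -> `|s3' - C| <= d ->
  [/\ `|c2 * s3' + s2 * c3' - (1 - 2 * (S * S))| <= 6 * d,
      `|s3' * c2' + c3' * s2' - - (2 * (S * C))| <= 6 * d &
      `|s2 * c3 + c2 * s3 - 2 * (S * C)| <= 6 * d].
Proof.
move=> d1 hS hC CS hc2 hc2' hs2 hs2' hc3 hc3' hs3 hs3'.
have hS' : `|- S| <= 1 by rewrite normrN.
have tri (x y x0 y0 t : R) : `|x - x0| <= 3 * d -> `|y - y0| <= 3 * d -> x0 + y0 = t ->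
    `|x + y - t| <= 6 * d.
  by move=> hx hy <-; have := ler_normD (x - x0) (y - y0); rewrite addrACA -opprD;
     clear -hx hy; lra.
split.
- apply: (tri _ _ (C * C) (S * - S)); rewrite ?normrM_near//; clear -CS; lra.
- apply: (tri _ _ (C * - S) (- S * C)); rewrite ?normrM_near//; ring.
- apply: (tri _ _ (S * C) (C * S)); rewrite ?normrM_near//; ring.
Qed.

(** [p1] and [p2] are Cramer's solution of the value condition on e2 together with p1 * c3' - p2 *
    s3' = s, whose determinant is - D. The sum of derivatives at x = 0, multiplied by - c1 * D, is
    the first row; the value condition on e3 is the second. The Wronskians being 1 makes the
    off-diagonal entries agree. *)
Lemma vertex_kernel (c1 c1' c2 c2' s2 s2' c3 c3' s3 s3' c s : R) :
  let D := c2 * s3' + s2 * c3' in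
  let E := s3' * c2' + c3' * s2' in
  let G := s2 * c3 + c2 * s3 in
  let p1 := (c * c1 * s3' + s * s2) / D in
  let p2 := (c * c1 * c3' - s * c2) / D in
  D != 0 -> c1 != 0 -> c2 * s2' - s2 * c2' = 1 -> c3 * s3' - s3 * c3' = 1 ->
  (- (c1' * c1) * D - E * (c1 * c1)) * c + (1 - D) * c1 * s = 0 ->
  (1 - D) * c1 * c + G * s = 0 ->
  [/\ c * c1 = p1 * c2 + p2 * s2, c * c1 = p1 * c3 - p2 * s3,
      c * c1' + p1 * (c2' + c3') + p2 * (s2' - s3') = 0 &
      p1 * c3' - p2 * s3' = s].
Proof.
move=> D E G p1 p2 D0 c10 w2 w3 r1 r2.
have {}r1 : - c1' * D * c - E * c1 * c + (1 - D) * s = 0.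
  by apply: (mulfI c10); rewrite mulr0 -r1; ring.
have p1D : p1 * D = c * c1 * s3' + s * s2 by rewrite /p1 divfK.
have p2D : p2 * D = c * c1 * c3' - s * c2 by rewrite /p2 divfK.
clearbody p1 p2; split; apply: (mulIf D0).
- transitivity (p1 * D * c2 + p2 * D * s2); last by ring.
  by rewrite p1D p2D /D; ring.
- transitivity (p1 * D * c3 - p2 * D * s3); last by ring.
  transitivity (c * c1 * (c3 * s3' - s3 * c3') + G * s); last by rewrite p1D p2D /G; ring.
  by rewrite w3 mulr1 -[LHS]addr0 -r2; ring.
- transitivity (c * c1' * D + p1 * D * (c2' + c3') + p2 * D * (s2' - s3')); first by ring.
  transitivity (c * c1' * D + c * c1 * E - s * (c2 * s2' - s2 * c2') + s * D).
    by rewrite p1D p2D /E /D; ring.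
  by rewrite w2 mulr1 mul0r -[RHS]oppr0 -r1; ring.
- transitivity (p1 * D * c3' - p2 * D * s3'); first by ring.
  by rewrite p1D p2D /D; ring.
Qed.

(* The conditions at x = 0 for the function equal to c C_1 on e1, p1 C_2 + p2 S_2
   on e2 and p1 C_3 - p2 S_3 on e3, where C_i and S_i solve y'' = (q - k^2) y with
   amplitudes (1, 0) and (0, 1) at the far end of the edge i; here c_i and s_i
   are their values at x = 0 and the primes are derivatives divided by k. *)
Definition vertex_cond (c1 c1' c2 c2' s2 s2' c3 c3' s3 s3' : R -> R) (k c p1 p2 : R) :=
  [/\ c * c1 k = p1 * c2 k + p2 * s2 k, c * c1 k = p1 * c3 k - p2 * s3 k &
      c * c1' k + p1 * (c2' k + c3' k) + p2 * (s2' k - s3' k) = 0].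

(** At [k0] the phase on the ring is exact and that on e1 misses a multiple of pi by at most e * l,
    which is the change of phase when k moves by e. So at k0 + e and k0 - e the deviation on e1 has
    the sign of the shift or vanishes, and e1 cannot oppose the ring in the first diagonal entry. *)
Lemma vertex_cond_pair (c1 c1' c2 c2' s2 s2' c3 c3' s3 s3' : R -> R) (a l e d k0 : R) (m n : nat) :
  let V := vertex_cond c1 c1' c2 c2' s2 s2' c3 c3' s3 s3' in
  let I := `[k0 - e, k0 + e]%classic : set R in
  0 < a -> 0 < l -> 0 < e -> 8 * (a * e) <= 1 -> 8 * (l * e) <= 1 ->
  0 <= d -> 60 * d <= a * e ->
  k0 * a = n%:R * pi -> `|k0 * l - m%:R * pi| <= e * l ->
  {within I, continuous c1} -> {within I, continuous c1'} ->
  {within I, continuous c2} -> {within I, continuous c2'} ->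
  {within I, continuous s2} -> {within I, continuous s2'} ->
  {within I, continuous c3} -> {within I, continuous c3'} ->
  {within I, continuous s3} -> {within I, continuous s3'} ->
  (forall k, k0 - e <= k <= k0 + e ->
    [/\ `|c1 k - cos (k * l)| <= d, `|c1' k - - sin (k * l)| <= d,
        [/\ `|c2 k - cos (k * a)| <= d, `|c2' k - - sin (k * a)| <= d,
            `|s2 k - sin (k * a)| <= d, `|s2' k - cos (k * a)| <= d &
            c2 k * s2' k - s2 k * c2' k = 1] &
        [/\ `|c3 k - cos (k * a)| <= d, `|c3' k - - sin (k * a)| <= d,
            `|s3 k - sin (k * a)| <= d, `|s3' k - cos (k * a)| <= d &
            c3 k * s3' k - s3 k * c3' k = 1]]) ->
  (exists k p1 p2, [/\ k0 - e <= k <= k0 + e, (p1, p2) <> (0, 0) & V k 0 p1 p2]) \/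
  (exists k k' p1 p2 p1' p2', [/\ k0 - e <= k <= k0 + e, k0 - e <= k' <= k0 + e, k != k',
     V k 1 p1 p2 & V k' 1 p1' p2']).
Proof.
move=> V I a0 l0 e0 ae le d0 dae kn km k1 k1' k2 k2' ks2 ks2' k3 k3' ks3 ks3' near.
have d1 : 0 <= d <= 1 by lra.
pose D k := c2 k * s3' k + s2 k * c3' k.
pose E k := s3' k * c2' k + c3' k * s2' k.
pose G k := s2 k * c3 k + c2 k * s3 k.
(* The entries are quadratic in the waves of each edge, so the signs from the multiples of pi
   cancel. *)
have sgn j : ((-1) ^+ j * (-1) ^+ j : R) = 1 by rewrite -exprMn mulrNN mulr1 expr1n.
have ka k : k * a = (k - k0) * a + n%:R * pi by rewrite -kn; ring.
have kl k : k * l = (k - k0) * l + (k0 * l - m%:R * pi) + m%:R * pi by ring.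
have ssa k : sin (k * a) * sin (k * a) = sin ((k - k0) * a) * sin ((k - k0) * a).
  by rewrite ka sinD_natpi mulrACA sgn mul1r.
have sca k : sin (k * a) * cos (k * a) = sin ((k - k0) * a) * cos ((k - k0) * a).
  by rewrite ka sinD_natpi cosD_natpi mulrACA sgn mul1r.
have DE k : k0 - e <= k <= k0 + e ->
   [/\ `|D k - (1 - 2 * (sin ((k - k0) * a) * sin ((k - k0) * a)))| <= 6 * d,
       `|E k - - (2 * (sin ((k - k0) * a) * cos ((k - k0) * a)))| <= 6 * d &
       `|G k - 2 * (sin ((k - k0) * a) * cos ((k - k0) * a))| <= 6 * d].
  move=> /near[_ _ [hc2 hc2' hs2 hs2' _] [hc3 hc3' hs3 hs3' _]].
  have C := normr_cos_le1 (k * a); have S := normr_sin_le1 (k * a).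
  rewrite -ssa -sca; apply: vertex_entries_near => //.
  by rewrite -!expr2 cos2Dsin2.
have dk k : k0 - e <= k <= k0 + e -> `|(k - k0) * a| <= a * e.
  by move=> ?; rewrite normrM mulrC (ger0_norm (ltW a0)) ler_pM2l// ler_norml; lra.
have D0 k : k0 - e <= k <= k0 + e -> 1 / 2 <= D k <= 2.
  move=> kI; have [+ _ _] := DE k kI; have h1 := dk k kI.
  have h2 := sin_le_small ((k - k0) * a).
  have h3 : `|sin ((k - k0) * a) * sin ((k - k0) * a)| <= 8^-1 * 8^-1.
    by rewrite normrM ler_pM//; lra.
  move: h3; rewrite !ler_norml => /andP[? ?] /andP[? ?]; lra.
have kl0 k : k0 - e <= k <= k0 + e -> `|(k - k0) * l + (k0 * l - m%:R * pi)| <= 4^-1.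
  move=> kI; have := ler_normD ((k - k0) * l) (k0 * l - m%:R * pi).
  have : `|(k - k0) * l| <= l * e.
    by rewrite normrM mulrC (ger0_norm (ltW l0)) ler_pM2l// ler_norml; lra.
  lra.
have c10 k : k0 - e <= k <= k0 + e -> 1 / 2 <= `|c1 k|.
  move=> kI; have [h _ _ _] := near k kI.
  have : 3 / 4 <= `|cos (k * l)|.
    rewrite kl cosD_natpi normrM normrX normrN1 expr1n mul1r.
    have := cos_ge_small ((k - k0) * l + (k0 * l - m%:R * pi)).
    by have := kl0 k kI; have := ler_norm (cos ((k - k0) * l + (k0 * l - m%:R * pi))); lra.
  have := ler_normD (c1 k) (- (c1 k - cos (k * l))).
  by rewrite opprB subrKC distrC; lra.
(* With s the derivative at x = 0 on e3, the conditions on (c, s) have a symmetric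
   matrix, since the Wronskians are 1. *)
pose al k := - (c1' k * c1 k) * D k - E k * (c1 k * c1 k).
pose be k := (1 - D k) * c1 k.
have cD : {within I, continuous D}.
  by move=> k; apply: cvgD; apply: cvgM; by [exact: k2|exact: ks3'|exact: ks2|exact: k3'].
have cE : {within I, continuous E}.
  by move=> k; apply: cvgD; apply: cvgM; by [exact: k2'|exact: ks3'|exact: ks2'|exact: k3'].
have cG : {within I, continuous G}.
  by move=> k; apply: cvgD; apply: cvgM; by [exact: k2|exact: ks3|exact: ks2|exact: k3].
have cbe : {within I, continuous be}.
  by move=> k; apply: cvgM; [apply: cvgB; [exact: cvg_cst|exact: cD]|exact: k1].
have cal : {within I, continuous al}.
  move=> k; apply: cvgB; apply: cvgM; try exact: cD; try exact: cE.
    by apply: cvgN; apply: cvgM; [exact: k1'|exact: k1].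
  by apply: cvgM; exact: k1.
have cc1 k : k0 - e <= k <= k0 + e ->
    `|c1' k * c1 k + sin ((k - k0) * l + (k0 * l - m%:R * pi)) *
                     cos ((k - k0) * l + (k0 * l - m%:R * pi))| <= 3 * d.
  move=> /near[h1 h2 _ _]; have C := normr_cos_le1 (k * l).
  have S' : `|- sin (k * l)| <= 1 by rewrite normrN normr_sin_le1.
  have := normrM_near d1 S' C h2 h1; rewrite mulNr opprK.
  by rewrite [X in sin X]kl [X in cos X]kl sinD_natpi cosD_natpi mulrACA sgn mul1r.
have c1le k : k0 - e <= k <= k0 + e -> `|c1 k| <= 9 / 8.
  move=> /near[h1 _ _ _]; have := normr_cos_le1 (k * l).
  by have := ler_normD (c1 k - cos (k * l)) (cos (k * l)); rewrite subrK; lra.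
have ae0 : 0 < a * e by rewrite mulr_gt0.
have right_dom : `|be (k0 + e)| < al (k0 + e) /\ `|be (k0 + e)| < G (k0 + e).
  have kI : k0 - e <= k0 + e <= k0 + e by clear -e0; lra.
  have [hD hE hG] := DE _ kI; have hu := cc1 _ kI.
  have eE : (k0 + e - k0) * a = a * e by ring.
  rewrite eE in hD hE hG.
  apply: (dominance_trig d0 dae ae0 ae _ hD hE hG hu); last exact: D0.
    have := kl0 _ kI; rewrite ler_norml => /andP[_ ->]; rewrite andbT.
    by move: km; rewrite ler_norml => /andP[]; clear; lra.
  by rewrite c10//= c1le.
(* Mirror image of the right end: negating E, G, c1' and the phase restores the hypotheses of
   [dominance_trig]. *)
have left_dom : `|be (k0 - e)| < - al (k0 - e) /\ `|be (k0 - e)| < - G (k0 - e).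
  have kI : k0 - e <= k0 - e <= k0 + e by clear -e0; lra.
  have [hD hE hG] := DE _ kI; have hu := cc1 _ kI.
  have eE : (k0 - e - k0) * a = - (a * e) by ring.
  rewrite eE sinN cosN mulrNN mulNr in hD hE hG.
  have zI := kl0 _ kI; set z := (k0 - e - k0) * l + (k0 * l - m%:R * pi) in hu zI.
  have hu' : `|- c1' (k0 - e) * c1 (k0 - e) + sin (- z) * cos (- z)| <= 3 * d.
    by rewrite sinN cosN !mulNr -opprD normrN.
  have hE' : `|- E (k0 - e) - - (2 * (sin (a * e) * cos (a * e)))| <= 6 * d.
    by rewrite -opprD normrN; move: hE; rewrite mulrN opprK.
  have hG' : `|- G (k0 - e) - 2 * (sin (a * e) * cos (a * e))| <= 6 * d.
    by rewrite -opprD normrN; move: hG; rewrite mulrN opprK.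
  have [||h1 h2] := dominance_trig d0 dae ae0 ae _ hD hE' hG' hu' _ (D0 _ kI).
  - move: zI; rewrite ler_norml => /andP[? _].
    by move: km; rewrite ler_norml /z => /andP[]; lra.
  - by rewrite c10//= c1le.
  split => //; rewrite [ltRHS](_ : _ = - (- c1' (k0 - e) * c1 (k0 - e)) * D (k0 - e) -
      - E (k0 - e) * (c1 (k0 - e) * c1 (k0 - e)))//.
  by rewrite /al; ring.
pose P1 k c s := (c * c1 k * s3' k + s * s2 k) / D k.
pose P2 k c s := (c * c1 k * c3' k - s * c2 k) / D k.
have Dn0 k : k0 - e <= k <= k0 + e -> D k != 0.
  by move=> /D0/andP[h _]; rewrite gt_eqF//; clear -h; lra.
have cond' k c s : k0 - e <= k <= k0 + e ->
    al k * c + be k * s = 0 -> be k * c + G k * s = 0 ->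
    V k c (P1 k c s) (P2 k c s) /\ P1 k c s * c3' k - P2 k c s * s3' k = s.
  move=> kI r1 r2; have [_ _ [_ _ _ _ w2] [_ _ _ _ w3]] := near k kI.
  have c1n0 : c1 k != 0 by rewrite -normr_gt0; have := c10 k kI; clear; lra.
  by have [] := vertex_kernel (Dn0 k kI) c1n0 w2 w3 r1 r2.
have cond k c s : k0 - e <= k <= k0 + e ->
    al k * c + be k * s = 0 -> be k * c + G k * s = 0 ->
    V k c (P1 k c s) (P2 k c s) by move=> kI r1 /(cond' _ _ _ kI r1)[].
have cond0 k c s : k0 - e <= k <= k0 + e -> al k * c + be k * s = 0 -> be k * c + G k * s = 0 ->
    s != 0 -> (P1 k c s, P2 k c s) <> (0, 0).
  move=> kI r1 /(cond' _ _ _ kI r1)[_ sE] s0 [h1 h2].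
  by rewrite h1 h2 !mul0r subr0 in sE; rewrite -sE eqxx in s0.
have [|||[k [kI ker]]|] := @sym2_pencil R al be G (k0 - e) (k0 + e) _ cal cbe cG _ _ right_dom.1 right_dom.2.
- by clear -e0; lra.
- by rewrite ltrNr left_dom.1.
- by rewrite ltrNr left_dom.2.
(* In a kernel equal to the plane the vector (c, s) = (0, 1) is available; s <> 0 keeps (p1, p2)
   from vanishing. *)
- left; exists k, (P1 k 0 1), (P2 k 0 1).
  have [|r1 r2 _] := ker 0 1; first by move=> -[/eqP]; rewrite oner_eq0.
  by split; [|apply: cond0; rewrite ?oner_neq0|exact: cond].
move=> [k [k' [c [s [c' [s' [kI k'I kk [r1 r2 n0] [r1' r2' n0']]]]]]]].
have [c0|c0] := eqVneq c 0.
  left; exists k, (P1 k 0 s), (P2 k 0 s); rewrite c0 in r1 r2 n0.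
  split; [by []|apply: cond0 => //|exact: cond].
  by apply/eqP => s0; apply: n0; rewrite s0.
have [c'0|c'0] := eqVneq c' 0.
  left; exists k', (P1 k' 0 s'), (P2 k' 0 s'); rewrite c'0 in r1' r2' n0'.
  split; [by []|apply: cond0 => //|exact: cond].
  by apply/eqP => s0; apply: n0'; rewrite s0.
right; exists k, k', (P1 k 1 (s / c)), (P2 k 1 (s / c)), (P1 k' 1 (s' / c')), (P2 k' 1 (s' / c')).
split => //; apply: cond => //.
- by apply: (mulIf c0); rewrite mul0r -r1; field.
- by apply: (mulIf c0); rewrite mul0r -r2; field.
- by apply: (mulIf c'0); rewrite mul0r -r1'; field.
- by apply: (mulIf c'0); rewrite mul0r -r2'; field.
Qed.

End VertexConditions.

(** * Eigenfunctions of the lasso *)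

Section Reflection.
Context {R : realType}.
Notation mu := (@lebesgue_measure R).

(** Composition with this projection extends a function on [0, L] by constants, so that a potential
    given on an edge becomes continuous and bounded on the line. *)
Definition clampI (L x : R) : R := ((id \max (fun=> 0)) \min (fun=> L)) x.

Arguments clampI : simpl never.

Lemma clampI_continuous L : continuous (clampI L).
Proof.
move=> x; apply: continuous_min; last exact: cst_continuous.
by apply: continuous_max; [by move=> t|exact: cst_continuous].
Qed.

Lemma clampI_itv L x : 0 < L -> 0 <= clampI L x <= L.
Proof.
move=> L0; rewrite /clampI/=.
by case: (leP x 0) => ?; [case: (leP 0 L) => ?|case: (leP x L) => ?]; lra.
Qed.

Lemma clampI_id L x : 0 <= x <= L -> clampI L x = x.
Proof.
move=> xL; rewrite /clampI/=.
by case: (leP x 0) => ?; [case: (leP 0 L) => ?|case: (leP x L) => ?]; lra.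
Qed.

Lemma continuous_clamp L (f : R -> R) : 0 < L -> {within `[0, L], continuous f} ->
  continuous (fun x => f (clampI L x)).
Proof.
move=> L0 cf x; have xL := clampI_itv x L0.
have /subspace_continuousP/(_ (clampI L x)) := cf.
rewrite /= in_itv/= => /(_ xL) H.
apply: cvg_comp H => A; rewrite /within/= => nA.
have h : nbhs x (clampI L @^-1` [set y | y \in `[0, L] -> A y]).
  exact: (@clampI_continuous L x _ nA).
change (nbhs x (clampI L @^-1` A)); apply: filterS h => t; apply.
by rewrite in_itv/= clampI_itv.
Qed.

Lemma within_continuous_bounded L (f : R -> R) : 0 < L -> {within `[0, L], continuous f} ->
  exists2 M, 0 <= M & forall x, 0 <= x <= L -> `|f x| <= M.
Proof.
move=> L0 cf; have [|c _ cM] := @EVT_max R (fun x => `|f x|) 0 L (ltW L0).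
  by move=> x; apply: cvg_norm; exact: cf.
by exists `|f c| => // x xL; apply: cM; rewrite in_itv.
Qed.

Lemma abs_cont_C1 L (f df : R -> R) : 0 < L ->
  (forall x : R, 0 <= x <= L -> is_derive x 1 f (df x)) ->
  {within `[0, L], continuous df} -> abs_cont L f.
Proof.
move=> L0 dF /(within_continuous_bounded L0)[M M0 HM].
apply: (@abs_cont_lipschitz _ _ M) => x y x0 xy yL.
by apply: (derive_le_lipschitz xy (df := df)) => z zxy; [apply: dF|apply: HM]; lra.
Qed.

Lemma is_derive_reflect (L x d : R) (f : R -> R) : is_derive (L - x) 1 f d ->
  is_derive x 1 (fun t => f (L - t)) (- d).
Proof.
move=> df; have h : is_derive x 1 (fun t : R => L - t) (-1).
  by have := is_deriveB (is_derive_cst L x 1) (is_derive_id x 1); rewrite sub0r.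
by have := @is_derive1_comp R f (fun t => L - t) x _ _ df h; rewrite mulrN1.
Qed.

Lemma ip2_reflect L (f g : R -> R) : 0 < L -> {within `[0, L], continuous f} ->
  {within `[0, L], continuous g} ->
  {within `[0, L], continuous (fun x => f (L - x))} ->
  {within `[0, L], continuous (fun x => g (L - x))} ->
  ip2 L (fun x => f (L - x)) (fun x => g (L - x)) = ip2 L f g.
Proof.
move=> L0 cf cg cf' cg'.
have /(continuous_clamp L0)/continuous_primitive[H [_ dH]] := within_continuousM cf cg.
have -> : ip2 L f g = H L - H 0.
  apply: ip2_ftc => // x xL; have := dH x; by rewrite clampI_id.
transitivity (- H (L - L) - - H (L - 0)); last by rewrite subrr subr0 opprK addrC.
apply: (ip2_ftc (Y := fun x => - H (L - x))) => //.
move=> x xL; have LxL : 0 <= L - x <= L by lra.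
have := dH (L - x); rewrite clampI_id// => /is_derive_reflect/is_deriveN.
by rewrite opprK.
Qed.

(** Pigeonhole: the fractional parts of the K + 1 numbers i * (N + 1) * theta fall into K boxes of
    width 1 / K < d. Sampling multiples of N + 1 forces the difference n above N. *)
Lemma dirichlet (theta d : R) (N : nat) : 0 < theta -> 0 < d ->
  exists n m : nat, (N < n)%N /\ `|n%:R * theta - m%:R| <= d.
Proof.
move=> t0 d0.
pose K := (Num.truncn d^-1).+1.
have K0 : 0 < K%:R :> R by rewrite ltr0n.
have dK : d^-1 < K%:R by exact: truncnS_gt.
clearbody K.
pose x (i : nat) := (i * N.+1)%:R * theta.
have x0 i : 0 <= x i by rewrite mulr_ge0// ltW.
pose t i := Num.truncn (x i).
have tI i : (t i)%:R <= x i < (t i)%:R + 1.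
  by have := truncn_itv (x0 i); rewrite natr1.
pose y i := K%:R * (x i - (t i)%:R).
have y0 i : 0 <= y i by apply: mulr_ge0; [exact: ltW|rewrite subr_ge0; have /andP[] := tI i].
have yK i : (Num.truncn (y i) < K)%N.
  rewrite -(ltr_nat R); apply: le_lt_trans (_ : y i < _); first by rewrite truncn_le.
  by rewrite /y -[ltRHS]mulr1 ltr_pM2l//; have := tI i; lra.
pose b (i : 'I_K.+1) : 'I_K := Ordinal (yK i).
have : ~ injective b.
  by move=> /leq_card; rewrite !card_ord ltnn.
move=> /injectiveP/injectivePn[i [j ij bij]].
wlog lij : i j ij bij / (i < j)%N.
  move=> H; have [/H//|ji|/val_inj e] := ltngtP i j; first exact.
    by apply: (H j i) => //; rewrite eq_sym.
  by rewrite e eqxx in ij.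
exists ((j - i) * N.+1)%N, (t j - t i)%N; split.
  apply: (@leq_trans (1 * N.+1)); first by rewrite mul1n.
  by rewrite leq_mul2r subn_gt0 lij orbT.
have xij : x i <= x j by rewrite ler_wpM2r ?(ltW t0)// ler_nat leq_mul2r (ltnW lij) orbT.
have tij : (t i <= t j)%N by rewrite truncn_le_nat -natr1; have := tI j; lra.
rewrite natrB// natrM natrB ?(ltnW lij)//.
have -> : (j%:R - i%:R) * N.+1%:R * theta - ((t j)%:R - (t i)%:R) = (y j - y i) / K%:R.
  by rewrite /y /x !natrM; field; rewrite gt_eqF.
have E : Num.truncn (y i) = Num.truncn (y j) by have /(congr1 val) := bij.
have := truncn_itv (y0 i); have := truncn_itv (y0 j); rewrite -!natr1 E => yj yi.
rewrite normrM normfV (gtr0_norm K0) ler_pdivrMr//.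
apply: (@le_trans _ _ 1); first by rewrite ler_norml; lra.
by rewrite -ler_pdivrMl// mulr1 ltW.
Qed.

End Reflection.

(** * From amplitudes to eigenfunctions *)

Section Modes.
Context {R : realType}.
Notation mu := (@lebesgue_measure R).
Variables (a l : R) (q : @gfun R).
Hypotheses (a0 : 0 < a) (l0 : 0 < l).
Hypothesis qc : forall e, {within `[0, len a l e], continuous (q e)}.

Lemma len_gt0 e : 0 < len a l e. Proof. by case: e. Qed.

(* Every edge is traversed from its end x = len e, so that the conditions at
   the boundary vertex and at the midpoint become initial conditions. *)
Definition pot (e : edge) (x : R) : R := q e (clampI (len a l e) (len a l e - x)).

Lemma pot_continuous e : continuous (pot e).
Proof.
move=> x; apply: (@continuous_comp _ _ _ (fun x => len a l e - x) (fun x => q e (clampI (len a l e) x))).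
  by apply: cvgB; [exact: cvg_cst|exact: cvg_id].
exact: (continuous_clamp (len_gt0 e) (@qc e)).
Qed.

Lemma pot_bounded : exists2 Q, 0 <= Q & forall e x, `|pot e x| <= Q.
Proof.
have B e : exists2 M, 0 <= M & forall x, 0 <= x <= len a l e -> `|q e x| <= M.
  exact: within_continuous_bounded (len_gt0 e) (@qc e).
have [M1 M10 H1] := B e1; have [M2 M20 H2] := B e2; have [M3 M30 H3] := B e3.
exists (M1 + M2 + M3); first by rewrite !addr_ge0.
move=> e x; have := clampI_itv (len a l e - x) (len_gt0 e); rewrite /pot.
by case: e => [/H1|/H2|/H3]; lra.
Qed.

Definition modefun (k : R) (A B : edge -> R -> R) : gfun :=
  fun e x => oscy k (A e) (B e) (len a l e - x).

(** The conditions of [domA] with edges reversed and derivatives divided by k: the group in brackets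
    holds at the boundary vertex and the midpoint, the last three at the interior vertex. *)
Definition mode (k : R) (A B : edge -> R -> R) : Prop :=
  let y e := oscy k (A e) (B e) (len a l e) in
  let w e := oscw k (A e) (B e) (len a l e) in
  [/\ forall e, osc (pot e) k (len a l e) (A e) (B e),
      [/\ B e1 0 = 0, A e2 0 = A e3 0 & B e2 0 + B e3 0 = 0],
      y e1 = y e2, y e1 = y e3 & w e1 + w e2 + w e3 = 0].

Lemma oscy0 k A B : oscy k A B 0 = A 0 :> R.
Proof. by rewrite /oscy mulr0 cos0 sin0 mulr1 mulr0 addr0. Qed.

Lemma oscw0 k A B : oscw k A B 0 = B 0 :> R.
Proof. by rewrite /oscw mulr0 cos0 sin0 mulr1 mulr0 add0r. Qed.

Section OneMode.
Variables (k : R) (A B : edge -> R -> R).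
Hypotheses (k0 : k != 0) (H : forall e, osc (pot e) k (len a l e) (A e) (B e)).
Let phi := modefun k A B.
Let dphi e (x : R) := - (k * oscw k (A e) (B e) (len a l e - x)).
Let ddphi e (x : R) := (pot e (len a l e - x) - k ^+ 2) * phi e x.

Lemma modefun_derive e x : 0 <= x <= len a l e -> is_derive x 1 (phi e) (dphi e x).
Proof.
move=> xL; have xL' : 0 <= len a l e - x <= len a l e by lra.
by have [d _] := osc_derive k0 (@H e) xL'; exact: is_derive_reflect d.
Qed.

Lemma modefun_derive2 e x : 0 <= x <= len a l e -> is_derive x 1 (dphi e) (ddphi e x).
Proof.
move=> xL; have xL' : 0 <= len a l e - x <= len a l e by lra.
have [_ d] := osc_derive k0 (@H e) xL'.
have := is_deriveZ (- k) (is_derive_reflect d).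
rewrite (_ : (- k) *: _ = ddphi e x).
  by rewrite (_ : (- k) \*: _ = dphi e)//; apply/funext => t; rewrite /dphi /= /GRing.scale/= mulNr.
by rewrite /GRing.scale/= /ddphi /phi /modefun; field.
Qed.

Lemma modefun_continuous e : {within `[0, len a l e], continuous (phi e)}.
Proof. exact: is_derive_within_continuous (@modefun_derive e). Qed.

Lemma modefun_inH : inH a l phi.
Proof. by move=> e; apply: L2_continuous; exact: modefun_continuous. Qed.

Lemma modefun_dI e x : 0 <= x <= len a l e ->
  derivableI (len a l e) (phi e) x /\ dI (len a l e) (phi e) x = dphi e x.
Proof.
move=> xL; apply: approxI_dI => //; first exact: len_gt0.
exact/is_derive_approxI/modefun_derive.
Qed.

Lemma modefun_dI2 e x : 0 <= x <= len a l e ->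
  dI (len a l e) (dI (len a l e) (phi e)) x = ddphi e x.
Proof.
move=> xL.
have [|_ //] := @approxI_dI R (len a l e) (dI (len a l e) (phi e)) x (ddphi e x) (len_gt0 e) xL.
(* [dI] is identified with [dphi] on the closed edge, exactly where [approxI] evaluates it. *)
apply: (approxI_eq xL (f := dphi e)) => [y yL|].
  by have [_ ->] := modefun_dI yL.
exact/is_derive_approxI/modefun_derive2.
Qed.

Lemma modefun_opA e x : 0 <= x <= len a l e -> opA a l q phi e x = k ^+ 2 * phi e x.
Proof.
move=> xL; rewrite /opA modefun_dI2// /ddphi.
have -> : pot e (len a l e - x) = q e x.
  by rewrite /pot opprB addrCA subrr addr0 clampI_id.
by ring.
Qed.

Lemma abs_cont_eq L f g : 0 < L -> (forall x, 0 <= x <= L -> f x = g x) ->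
  @abs_cont R L f -> abs_cont L g.
Proof.
move=> L0 fg acf eps eps0; have [d d0 Hd] := acf eps eps0; exists d => // n x y xy tI xyd.
rewrite (eq_bigr (fun i => `|f (y i) - f (x i)|)); first exact: Hd.
by move=> i _; rewrite !fg//; have := xy i; lra.
Qed.

End OneMode.

Lemma mode_eigenmode k A B : k != 0 -> mode k A B -> eigenmode a l q k (modefun k A B).
Proof.
move=> k0 [H [B1 A23 B23] y12 y13 wsum].
set phi := modefun k A B.
have bd e : 0 <= (0 : R) <= len a l e by rewrite lexx ltW ?len_gt0.
have bdL e : 0 <= len a l e <= len a l e by rewrite lexx ltW ?len_gt0.
have D0 e : dout0 a l phi e = - (k * oscw k (A e) (B e) (len a l e)).
  by rewrite /dout0; have [_ ->] := modefun_dI k0 H (bd e); rewrite subr0.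
have DL e : doutl a l phi e = k * B e 0.
  by rewrite /doutl; have [_ ->] := modefun_dI k0 H (bdL e); rewrite opprK subrr oscw0.
have V0 e : phi e 0 = oscy k (A e) (B e) (len a l e) by rewrite /phi /modefun subr0.
have VL e : phi e (len a l e) = A e 0 by rewrite /phi /modefun subrr oscy0.
have Hphi : inH a l phi by exact: modefun_inH.
split => //; last first.
  by move=> e x /andP[x0 xL]; apply: modefun_opA => //; rewrite !ltW.
split; [|split; [|split; [|split]]].
- move=> e; split.
  + apply: (abs_cont_C1 (len_gt0 e) (modefun_derive k0 H (e := e))).
    exact: is_derive_within_continuous (modefun_derive2 k0 H (e := e)).
  + by move=> x; rewrite in_itv/= => /(modefun_dI k0 H)[].
  + apply: (@abs_cont_eq _ (fun x => - (k * oscw k (A e) (B e) (len a l e - x)))).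
    * exact: len_gt0.
    * by move=> x /(modefun_dI k0 H)[_ ->].
    * apply: (abs_cont_C1 (len_gt0 e) (modefun_derive2 k0 H (e := e))).
      apply: within_continuousM; last exact: modefun_continuous.
      apply: continuous_subspaceT => x; apply: cvgB; last exact: cvg_cst.
      apply: (@continuous_comp _ _ _ (fun x => len a l e - x) (pot e)).
        by apply: cvgB; [exact: cvg_cst|exact: cvg_id].
      exact: pot_continuous.
- move=> e; apply: (@L2_eq _ _ (fun x => k ^+ 2 * phi e x)); last exact/L2Z/Hphi.
  by move=> x /andP[x0 xL]; rewrite modefun_opA// !ltW.
- by rewrite DL B1 mulr0.
- by split; [rewrite (VL e2) (VL e3)|rewrite !DL -mulrDr B23 mulr0].
- split; first by rewrite !V0.
  split; first by rewrite !V0.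
  by rewrite !D0 -!opprD -!mulrDr wsum mulr0 oppr0.
Qed.

Lemma ipH_mode k k' A B A' B' : k != 0 -> k' != 0 ->
  (forall e, osc (pot e) k (len a l e) (A e) (B e)) ->
  (forall e, osc (pot e) k' (len a l e) (A' e) (B' e)) ->
  ipH a l (modefun k A B) (modefun k' A' B') =
  ip2 l (oscy k (A e1) (B e1)) (oscy k' (A' e1) (B' e1)) +
  ip2 a (oscy k (A e2) (B e2)) (oscy k' (A' e2) (B' e2)) +
  ip2 a (oscy k (A e3) (B e3)) (oscy k' (A' e3) (B' e3)).
Proof.
move=> k0 k'0 H H'.
have cy e := (osc_within_continuous k0 (H e)).1.
have cy' e := (osc_within_continuous k'0 (H' e)).1.
have cf e := modefun_continuous k0 H (e := e).
have cf' e := modefun_continuous k'0 H' (e := e).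
by congr (_ + _ + _); [apply: (ip2_reflect l0 (cy e1) (cy' e1) (cf e1) (cf' e1))
  |apply: (ip2_reflect a0 (cy e2) (cy' e2) (cf e2) (cf' e2))
  |apply: (ip2_reflect a0 (cy e3) (cy' e3) (cf e3) (cf' e3))].
Qed.

(** Self-adjointness: adding Green's identity over the edges, the vertex conditions cancel all
    boundary terms, and k^2 - k'^2 is nonzero. *)
Lemma mode_orthogonal k k' A B A' B' : 0 < k -> 0 < k' -> k != k' -> mode k A B -> mode k' A' B' ->
  ipH a l (modefun k A B) (modefun k' A' B') = 0.
Proof.
move=> k0 k'0 kk' [H [B1 A23 B23] y12 y13 ws] [H' [B1' A23' B23'] y12' y13' ws'].
have kn0 : k != 0 by rewrite gt_eqF.
have k'n0 : k' != 0 by rewrite gt_eqF.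
rewrite ipH_mode//.
have kk : k ^+ 2 - k' ^+ 2 != 0.
  by rewrite subr_sqr mulf_neq0 ?subr_eq0// gt_eqF// addr_gt0.
apply: (mulfI kk); rewrite mulr0 !mulrDr.
rewrite (osc_green l0 kn0 k'n0 (H e1) (H' e1)).
rewrite (osc_green a0 kn0 k'n0 (H e2) (H' e2)) (osc_green a0 kn0 k'n0 (H e3) (H' e3)).
rewrite !oscw0 !oscy0 B1 B1'.
rewrite /= in y12 y13 y12' y13' ws ws'.
rewrite -y12 -y13 -y12' -y13' -A23 -A23'.
have -> : B e3 0 = - B e2 0 by apply/eqP; rewrite -addr_eq0 addrC B23.
have -> : B' e3 0 = - B' e2 0 by apply/eqP; rewrite -addr_eq0 addrC B23'.
have -> : oscw k (A e3) (B e3) a = - (oscw k (A e1) (B e1) l + oscw k (A e2) (B e2) a).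
  by apply/eqP; rewrite -addr_eq0 addrC ws.
have -> : oscw k' (A' e3) (B' e3) a = - (oscw k' (A' e1) (B' e1) l + oscw k' (A' e2) (B' e2) a).
  by apply/eqP; rewrite -addr_eq0 addrC ws'.
ring.
Qed.

End Modes.

(** * Endpoint data and linear combinations *)

Section Families.
Context {R : realType}.
Implicit Types (p : R -> R) (k L Q : R).

Lemma oscw_le2 k (A B : R -> R) A0 B0 (x : R) :
  `|oscw k A B x - (- A0 * sin (k * x) + B0 * cos (k * x))| <= `|A x - A0| + `|B x - B0|.
Proof.
apply: le_trans (oscw_le k (fun t => A t - A0) (fun t => B t - B0) x).
by rewrite le_eqVlt; apply/orP; left; apply/eqP; congr (`|_|); rewrite /oscw; ring.
Qed.

Lemma oscy_le2 k (A B : R -> R) A0 B0 (x : R) :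
  `|oscy k A B x - (A0 * cos (k * x) + B0 * sin (k * x))| <= `|A x - A0| + `|B x - B0|.
Proof.
apply: le_trans (oscy_le k (fun t => A t - A0) (fun t => B t - B0) x).
by rewrite le_eqVlt; apply/orP; left; apply/eqP; congr (`|_|); rewrite /oscy; ring.
Qed.

Lemma osc_end_near p k L Q (A B : R -> R) A0 B0 d : 0 < k -> 0 < L -> (forall x, `|p x| <= Q) ->
  4 * L * Q <= k -> 4 * L * Q <= d * k -> osc p k L A B -> A 0 = A0 -> B 0 = B0 ->
  `|A0| + `|B0| <= 1 ->
  `|oscy k A B L - (A0 * cos (k * L) + B0 * sin (k * L))| <= d /\
  `|oscw k A B L - (- A0 * sin (k * L) + B0 * cos (k * L))| <= d.
Proof.
move=> k0 L0 pQ kQ kd H AE BE AB1; have Q0 : 0 <= Q by apply: le_trans (pQ 0).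
have LL : 0 <= L <= L by rewrite lexx ltW.
have [] := osc_amplitude_near k0 L0 pQ kQ H LL; rewrite AE BE => hA hB.
have h : 2 * L * Q / k * (`|A0| + `|B0|) <= d / 2.
  apply: (@le_trans _ _ (2 * L * Q / k * 1)).
    by rewrite ler_wpM2l// !mulr_ge0 ?invr_ge0 ?(ltW k0) ?(ltW L0).
  by rewrite mulr1 ler_pdivrMr//; lra.
split; [apply: (le_trans (oscy_le2 _ _ _ _ _ _))|apply: (le_trans (oscw_le2 _ _ _ _ _ _))]; lra.
Qed.

Lemma lipschitz_within_continuous (x y M : R) (f : R -> R) :
  (forall k k', x <= k -> x <= k' -> `|f k - f k'| <= M * `|k - k'|) ->
  {within `[x, y], continuous f}.
Proof.
move=> Hf; apply/subspace_continuousP => z /=; rewrite in_itv/= => /andP[xz zy].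
apply/cvgrPdist_le => e e0; rewrite /within/=; apply/nbhs_ballP.
have M1 : 0 < `|M| + 1 by rewrite ltr_wpDl.
exists (e / (`|M| + 1)) => /=; first by rewrite divr_gt0.
move=> t; rewrite /ball/= ltr_pdivlMr// => zt; rewrite in_itv/= => /andP[xt ty].
apply: (le_trans (Hf _ _ xz xt)); apply: le_trans (ltW zt).
by rewrite mulrC ler_wpM2l//; have := ler_norm M; lra.
Qed.

Lemma osc_end_continuous p L Q (A B : R -> R -> R) A0 B0 (x y : R) : 0 < L ->
  (forall x, `|p x| <= Q) -> 1 <= x -> 4 * L * Q <= x ->
  (forall k, x <= k -> [/\ A k 0 = A0, B k 0 = B0 & osc p k L (A k) (B k)]) ->
  {within `[x, y], continuous (fun k => oscy k (A k) (B k) L)} /\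
  {within `[x, y], continuous (fun k => oscw k (A k) (B k) L)}.
Proof.
move=> L0 pQ x1 xQ H; have LL : 0 <= L <= L by rewrite lexx ltW.
pose M := 4 * L * (Q * (2 * (`|A0| + `|B0|)) * (2 * L + 1)).
have AB k k' : x <= k -> x <= k' -> `|A k L - A k' L| + `|B k L - B k' L| <= M * `|k - k'|.
  move=> xk xk'; have [a1 b1 h1] := H k xk; have [a2 b2 h2] := H k' xk'.
  apply: (osc_lipschitz L0 pQ _ _ _ _ h1 h2) => //; try lra; by rewrite ?a1 ?a2 ?b1 ?b2.
have cA : {within `[x, y], continuous (fun k => A k L)}.
  apply: (@lipschitz_within_continuous _ _ M) => k k' xk xk'.
  by have := AB k k' xk xk'; have := normr_ge0 (B k L - B k' L); lra.
have cB : {within `[x, y], continuous (fun k => B k L)}.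
  apply: (@lipschitz_within_continuous _ _ M) => k k' xk xk'.
  by have := AB k k' xk xk'; have := normr_ge0 (A k L - A k' L); lra.
have cc : {within `[x, y], continuous (fun k => cos (k * L))}.
  apply: (@lipschitz_within_continuous _ _ L) => k k' _ _.
  by apply: (le_trans (cos_lipschitz _ _)); rewrite -mulrBl normrM mulrC (gtr0_norm L0).
have cs : {within `[x, y], continuous (fun k => sin (k * L))}.
  apply: (@lipschitz_within_continuous _ _ L) => k k' _ _.
  by apply: (le_trans (sin_lipschitz _ _)); rewrite -mulrBl normrM mulrC (gtr0_norm L0).
split => z; rewrite /oscy /oscw.
  by apply: cvgD; apply: cvgM; by [exact: cA|exact: cB|exact: cc|exact: cs].
by apply: cvgD; apply: cvgM; try (apply: cvgN); by [exact: cA|exact: cB|exact: cc|exact: cs].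
Qed.

Lemma osc_comb p k L (A B A' B' : R -> R) (c c' : R) : osc p k L A B -> osc p k L A' B' ->
  osc p k L (fun x => c * A x + c' * A' x) (fun x => c * B x + c' * B' x).
Proof.
move=> H H' x xL; have [d1 d2] := H x xL; have [d3 d4] := H' x xL.
split; apply: is_derive_eq; rewrite /GRing.scale/= /oscy; ring.
Qed.

Lemma oscy_comb k (A B A' B' : R -> R) (c c' x : R) :
  oscy k (fun x => c * A x + c' * A' x) (fun x => c * B x + c' * B' x) x =
  c * oscy k A B x + c' * oscy k A' B' x.
Proof. by rewrite /oscy; ring. Qed.

Lemma oscw_comb k (A B A' B' : R -> R) (c c' x : R) :
  oscw k (fun x => c * A x + c' * A' x) (fun x => c * B x + c' * B' x) x =
  c * oscw k A B x + c' * oscw k A' B' x.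
Proof. by rewrite /oscw; ring. Qed.

End Families.

(** * Eigenfunctions at large frequency *)

Section TwoModes.
Context {R : realType}.
Variables (a l : R) (q : @gfun R).
Hypotheses (a0 : 0 < a) (l0 : 0 < l).
Hypothesis qc : forall e, {within `[0, len a l e], continuous (q e)}.

(** It has two uses: an eigenfunction with nonzero data at the midpoint is nonzero, and one with
    boundary value 1 has squared norm at least c, uniformly in k. *)
Lemma mode_lower : exists K c : R, [/\ 0 < K, 0 < c & forall k A B, K <= k -> mode a l q k A B ->
  c * (A e1 0 ^+ 2 + (A e2 0 ^+ 2 + B e2 0 ^+ 2)) <= ipH a l (modefun a l k A B) (modefun a l k A B)].
Proof.
have [Q Q0 pQ] := pot_bounded a0 l0 qc.
have cp e := @pot_continuous R a l q a0 l0 qc e.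
pose K := 1 + 8 * l * Q + 8 * a * Q + (64 * l * Q + 128) / l + (64 * a * Q + 128) / a.
have lQ : 0 <= l * Q by rewrite mulr_ge0// ltW.
have aQ : 0 <= a * Q by rewrite mulr_ge0// ltW.
have lK : 0 <= (64 * l * Q + 128) / l by rewrite divr_ge0 ?(ltW l0)//; lra.
have aK : 0 <= (64 * a * Q + 128) / a by rewrite divr_ge0 ?(ltW a0)//; lra.
exists K, (Num.min l a / 16); split.
- by rewrite /K; lra.
- by rewrite divr_gt0// lt_min l0.
move=> k A B Kk [H [B1 _ _] _ _ _].
have k0 : k != 0 by rewrite gt_eqF//; rewrite /K in Kk; lra.
rewrite (ipH_mode a0 l0 k0 k0 H H).
have h1 := @osc_ip2_lower R (pot a l q e1) k l Q (A e1) (B e1) l0 (cp e1) (pQ e1).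
have h2 := @osc_ip2_lower R (pot a l q e2) k a Q (A e2) (B e2) a0 (cp e2) (pQ e2).
have {}h1 : l / 16 * (A e1 0 ^+ 2 + B e1 0 ^+ 2) <= ip2 l (oscy k (A e1) (B e1)) (oscy k (A e1) (B e1)).
  apply: h1; [| | |exact: (H e1)].
  - by rewrite /K in Kk; lra.
  - by rewrite /K in Kk; lra.
  - by rewrite [leRHS]mulrC -ler_pdivrMr//; rewrite /K in Kk; lra.
have {}h2 : a / 16 * (A e2 0 ^+ 2 + B e2 0 ^+ 2) <= ip2 a (oscy k (A e2) (B e2)) (oscy k (A e2) (B e2)).
  apply: h2; [| | |exact: (H e2)].
  - by rewrite /K in Kk; lra.
  - by rewrite /K in Kk; lra.
  - by rewrite [leRHS]mulrC -ler_pdivrMr//; rewrite /K in Kk; lra.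
have h3 := ip2_ge0 a (oscy k (A e3) (B e3)).
have m1 : Num.min l a / 16 * (A e1 0 ^+ 2) <= l / 16 * (A e1 0 ^+ 2).
  by rewrite ler_wpM2r ?sqr_ge0// ler_pM2r// ge_min lexx.
have m2 : Num.min l a / 16 * (A e2 0 ^+ 2 + B e2 0 ^+ 2) <= a / 16 * (A e2 0 ^+ 2 + B e2 0 ^+ 2).
  by rewrite ler_wpM2r ?addr_ge0 ?sqr_ge0// ler_pM2r// ge_min lexx orbT.
rewrite B1 expr0n/= addr0 in h1.
rewrite mulrDr; clear -h1 h2 h3 m1 m2; lra.
Qed.

Lemma modes_exist (K e : R) : 0 < e -> 8 * (a * e) <= 1 -> 8 * (l * e) <= 1 ->
  (exists k A B, [/\ K <= k, mode a l q k A B, A e1 0 = 0 & (A e2 0, B e2 0) <> (0, 0)]) \/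
  (exists k k' A B A' B', [/\ K <= k, K <= k', k != k', `|k - k'| <= 2 * e &
     [/\ mode a l q k A B, mode a l q k' A' B', A e1 0 = 1 & A' e1 0 = 1]]).
Proof.
move=> e0 ae le.
have [Q Q0 pQ] := pot_bounded a0 l0 qc.
have cp i := @pot_continuous R a l q a0 l0 qc i.
have L0 i := @len_gt0 R a l a0 l0 i.
pose d := a * e / 60.
have ae0 : 0 < a * e by rewrite mulr_gt0.
have d0 : 0 < d by rewrite /d divr_gt0.
have lQ : 0 <= l * Q by rewrite mulr_ge0// ltW.
have aQ : 0 <= a * Q by rewrite mulr_ge0// ltW.
pose K0 := 1 + 4 * Q * (l + 1) + 4 * Q * (a + 1).
have K0l i : 1 + 4 * Q * (len a l i + 1) <= K0 by rewrite /K0; case: i => /=; lra.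
have K0L i : 4 * len a l i * Q <= K0 by rewrite /K0; case: i => /=; lra.
have K01 : 1 <= K0 by rewrite /K0; lra.
have [AC [BC HC]] : exists A B : edge -> R -> R -> R, forall i k, K0 <= k ->
    [/\ A i k 0 = 1, B i k 0 = 0 & osc (pot a l q i) k (len a l i) (A i k) (B i k)].
  have F i := @osc_family R (pot a l q i) (len a l i) Q 1 0 (L0 i) (cp i) (pQ i).
  have [A1 [B1 H1]] := F e1; have [A2 [B2 H2]] := F e2; have [A3 [B3 H3]] := F e3.
  exists (fun i => match i with e1 => A1 | e2 => A2 | e3 => A3 end).
  exists (fun i => match i with e1 => B1 | e2 => B2 | e3 => B3 end).
  move=> i k Kk; have := le_trans (K0l i) Kk.
  by case: i => h; [exact: H1|exact: H2|exact: H3].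
have [AS [BS HS]] : exists A B : edge -> R -> R -> R, forall i k, K0 <= k ->
    [/\ A i k 0 = 0, B i k 0 = 1 & osc (pot a l q i) k (len a l i) (A i k) (B i k)].
  have F i := @osc_family R (pot a l q i) (len a l i) Q 0 1 (L0 i) (cp i) (pQ i).
  have [A1 [B1 H1]] := F e1; have [A2 [B2 H2]] := F e2; have [A3 [B3 H3]] := F e3.
  exists (fun i => match i with e1 => A1 | e2 => A2 | e3 => A3 end).
  exists (fun i => match i with e1 => B1 | e2 => B2 | e3 => B3 end).
  move=> i k Kk; have := le_trans (K0l i) Kk.
  by case: i => h; [exact: H1|exact: H2|exact: H3].
(* Above [K1] the potential changes the endpoint data by at most d. *)
pose K1 := K0 + `|K| + 4 * l * Q / d + 4 * a * Q / d.
have lQd : 0 <= 4 * l * Q / d by rewrite divr_ge0 ?(ltW d0)//; lra.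
have aQd : 0 <= 4 * a * Q / d by rewrite divr_ge0 ?(ltW d0)//; lra.
have K1K0 : K0 <= K1 by rewrite /K1; have := normr_ge0 K; lra.
have K1K : K <= K1 by rewrite /K1; have := ler_norm K; lra.
have K1d i k : K1 <= k -> 4 * len a l i * Q <= d * k.
  move=> Kk; rewrite [leRHS]mulrC -ler_pdivrMr//.
  by move: Kk; rewrite /K1; have := normr_ge0 K; case: i => /=; lra.
have pi0 : 0 < pi :> R by exact: pi_gt0.
have thr0 : 0 <= a / pi * (K1 + e).
  by rewrite mulr_ge0 ?divr_ge0 ?(ltW a0) ?(ltW pi0)//; lra.
(* For k0 = n pi / a the tolerance becomes e * l after multiplication by pi, and the lower bound on
   n puts all of [k0 - e, k0 + e] above [K1]. *)
have [n [m [Nn nm]]] := @dirichlet R (l / a) (e * l / pi) (Num.truncn (a / pi * (K1 + e)))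
  (divr_gt0 l0 a0) (divr_gt0 (mulr_gt0 e0 l0) pi0).
pose k0 : R := n%:R * pi / a.
have k0K : K1 + e <= k0.
  rewrite /k0 ler_pdivlMr// -ler_pdivrMr//.
  have -> : (K1 + e) * a / pi = a / pi * (K1 + e) by ring.
  apply/ltW/(lt_le_trans (truncnS_gt _)); by rewrite ler_nat.
have k0a : k0 * a = n%:R * pi by rewrite /k0 divfK// gt_eqF.
have k0l : `|k0 * l - m%:R * pi| <= e * l.
  have -> : k0 * l - m%:R * pi = (n%:R * (l / a) - m%:R) * pi.
    by rewrite /k0; field; rewrite gt_eqF.
  by rewrite normrM (gtr0_norm pi0) -ler_pdivlMr.
have near_k0 k : k0 - e <= k <= k0 + e -> K1 <= k by lra.
pose yC i k := oscy k (AC i k) (BC i k) (len a l i).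
pose wC i k := oscw k (AC i k) (BC i k) (len a l i).
pose yS i k := oscy k (AS i k) (BS i k) (len a l i).
pose wS i k := oscw k (AS i k) (BS i k) (len a l i).
have x1 : 1 <= k0 - e by lra.
have xQ i : 4 * len a l i * Q <= k0 - e by have := K0L i; lra.
have xK k : k0 - e <= k -> K0 <= k by lra.
have cC i := @osc_end_continuous R (pot a l q i) (len a l i) Q (AC i) (BC i) 1 0 (k0 - e) (k0 + e)
  (L0 i) (pQ i) x1 (xQ i) (fun k h => HC i k (xK k h)).
have cS i := @osc_end_continuous R (pot a l q i) (len a l i) Q (AS i) (BS i) 0 1 (k0 - e) (k0 + e)
  (L0 i) (pQ i) x1 (xQ i) (fun k h => HS i k (xK k h)).
have nC i k : k0 - e <= k <= k0 + e -> `|yC i k - cos (k * len a l i)| <= d /\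
    `|wC i k - - sin (k * len a l i)| <= d.
  move=> /near_k0 kK; have [A1 B1 H1] := HC i k (le_trans K1K0 kK).
  have := @osc_end_near R (pot a l q i) k (len a l i) Q (AC i k) (BC i k) 1 0 d _ (L0 i) (pQ i) _ (K1d i k kK) H1 A1 B1.
  rewrite mul1r !mul0r !addr0 mulN1r; apply.
  - by lra.
  - by have := K0L i; lra.
  - by rewrite normr1 normr0 addr0.
have nS i k : k0 - e <= k <= k0 + e -> `|yS i k - sin (k * len a l i)| <= d /\
    `|wS i k - cos (k * len a l i)| <= d.
  move=> /near_k0 kK; have [A1 B1 H1] := HS i k (le_trans K1K0 kK).
  have := @osc_end_near R (pot a l q i) k (len a l i) Q (AS i k) (BS i k) 0 1 d _ (L0 i) (pQ i) _ (K1d i k kK) H1 A1 B1.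
  rewrite oppr0 !mul1r !mul0r !add0r; apply.
  - by lra.
  - by have := K0L i; lra.
  - by rewrite normr1 normr0 add0r.
have W i k : k0 - e <= k <= k0 + e -> yC i k * wS i k - yS i k * wC i k = 1.
  move=> /near_k0 kK; have [A1 B1 H1] := HC i k (le_trans K1K0 kK).
  have [A2 B2 H2] := HS i k (le_trans K1K0 kK).
  have kn0 : k != 0 by rewrite gt_eqF//; lra.
  have := osc_wronskian (L0 i) kn0 H1 H2; rewrite A1 B1 A2 B2 mulr1 mulr0 subr0 => <-.
  rewrite /yC /wS /yS /wC /oscy /oscw; set C := cos _; set S := sin _.
  transitivity ((AC i k (len a l i) * BS i k (len a l i) - BC i k (len a l i) * AS i k (len a l i)) *
    (C ^+ 2 + S ^+ 2)); first by ring.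
  by rewrite cos2Dsin2 mulr1.
(* The opposite coefficients of the sine solutions on e2 and e3 give balanced derivatives at the
   midpoint; the zero coefficient on e1 is the Neumann condition. *)
pose Am k c p p' i x := match i with e1 => c * AC e1 k x + 0 * AS e1 k x
  | e2 => p * AC e2 k x + p' * AS e2 k x | e3 => p * AC e3 k x + (- p') * AS e3 k x end.
pose Bm k c p p' i x := match i with e1 => c * BC e1 k x + 0 * BS e1 k x
  | e2 => p * BC e2 k x + p' * BS e2 k x | e3 => p * BC e3 k x + (- p') * BS e3 k x end.
have toMode k c p p' : k0 - e <= k <= k0 + e ->
    vertex_cond (yC e1) (wC e1) (yC e2) (wC e2) (yS e2) (wS e2) (yC e3) (wC e3) (yS e3) (wS e3) k c p p' ->
    [/\ mode a l q k (Am k c p p') (Bm k c p p'), Am k c p p' e1 0 = c,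
        Am k c p p' e2 0 = p & Bm k c p p' e2 0 = p'].
  move=> /near_k0 kK [V1 V2 V3]; have kK0 := le_trans K1K0 kK.
  have hc i := HC i k kK0; have hs i := HS i k kK0.
  have cA i : AC i k 0 = 1 by have [] := hc i.
  have cB i : BC i k 0 = 0 by have [] := hc i.
  have sA i : AS i k 0 = 0 by have [] := hs i.
  have sB i : BS i k 0 = 1 by have [] := hs i.
  have oC i : osc (pot a l q i) k (len a l i) (AC i k) (BC i k) by have [] := hc i.
  have oS i : osc (pot a l q i) k (len a l i) (AS i k) (BS i k) by have [] := hs i.
  have A0 : [/\ Am k c p p' e1 0 = c, Am k c p p' e2 0 = p, Am k c p p' e3 0 = p &
     [/\ Bm k c p p' e1 0 = 0, Bm k c p p' e2 0 = p' & Bm k c p p' e3 0 = - p']].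
    by rewrite /Am /Bm !cA !cB !sA !sB; split; [ring|ring|ring|split; ring].
  have [A1 A2 A3 [B1 B2 B3]] := A0.
  split => //; split.
  - by case; [exact: osc_comb|exact: osc_comb|exact: osc_comb].
  - by rewrite A2 A3 B1 B2 B3 subrr.
  - by rewrite /Am /Bm !oscy_comb mul0r addr0; exact: V1.
  - by rewrite /Am /Bm !oscy_comb mul0r addr0 mulNr; exact: V2.
  - rewrite /Am /Bm !oscw_comb mul0r addr0 mulNr -V3 /wC /wS /=; ring.
have [||[k [p [p' [kI pp /(toMode _ _ _ _ kI)[mo c1 pE p'E]]]]]|] := 
   @vertex_cond_pair R (yC e1) (wC e1) (yC e2) (wC e2) (yS e2) (wS e2) (yC e3) (wC e3) (yS e3) (wS e3)
     a l e d k0 m n a0 l0 e0 ae le (ltW d0) _ k0a k0l (cC e1).1 (cC e1).2 (cC e2).1 (cC e2).2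
     (cS e2).1 (cS e2).2 (cC e3).1 (cC e3).2 (cS e3).1 (cS e3).2 _.
- by rewrite /d; lra.
- move=> k kI; split; [exact: (nC e1 k kI).1|exact: (nC e1 k kI).2| |].
  + by split; [exact: (nC e2 k kI).1|exact: (nC e2 k kI).2|exact: (nS e2 k kI).1|exact: (nS e2 k kI).2|exact: W].
  + by split; [exact: (nC e3 k kI).1|exact: (nC e3 k kI).2|exact: (nS e3 k kI).1|exact: (nS e3 k kI).2|exact: W].
- left; exists k, (Am k 0 p p'), (Bm k 0 p p'); split => //.
    by apply: le_trans K1K _; exact: near_k0.
  by rewrite pE p'E.
move=> [k [k' [p1 [p2 [p1' [p2' [kI k'I kk /(toMode _ _ _ _ kI)[mo c1 _ _] /(toMode _ _ _ _ k'I)[mo' c1' _ _]]]]]]]].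
right; exists k, k', (Am k 1 p1 p2), (Bm k 1 p1 p2), (Am k' 1 p1' p2'), (Bm k' 1 p1' p2').
split => //.
- by apply: le_trans K1K _; exact: near_k0.
- by apply: le_trans K1K _; exact: near_k0.
- by rewrite ler_norml; lra.
Qed.

End TwoModes.

(** * Lack of controllability *)

Section GraphInnerProduct.
Context {R : realType}.
Variables (a l : R).
Implicit Types (u phi psi : @gfun R).

Lemma ip2Br (L : R) (f g h : R -> R) : L2 L f -> L2 L g -> L2 L h ->
  ip2 L f (fun x => g x - h x) = ip2 L f g - ip2 L f h.
Proof.
move=> hf hg hh; rewrite -[- ip2 L f h]mulN1r -(@ip2Zr _ L (-1) f h (fun x => - h x))//.
  by rewrite -ip2Dr//; apply: L2_eq (L2Z (-1) hh) => x _; rewrite mulN1r.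
by move=> x _; rewrite mulN1r.
Qed.

Lemma inH_gsub phi psi : inH a l phi -> inH a l psi -> inH a l (gsub phi psi).
Proof.
move=> h1 h2 e; apply: (@L2_eq _ _ (fun x => phi e x + (-1) * psi e x)).
  by move=> x _; rewrite mulN1r.
by apply: L2D; [exact: h1|exact/L2Z/h2].
Qed.

Lemma ipHBr u phi psi : inH a l u -> inH a l phi -> inH a l psi ->
  ipH a l u (gsub phi psi) = ipH a l u phi - ipH a l u psi.
Proof.
move=> hu h1 h2; rewrite /ipH /gsub.
rewrite (ip2Br (hu e1) (h1 e1) (h2 e1)) (ip2Br (hu e2) (h1 e2) (h2 e2)).
by rewrite (ip2Br (hu e3) (h1 e3) (h2 e3)); ring.
Qed.

Lemma ipHC u phi : ipH a l u phi = ipH a l phi u.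
Proof. by congr (_ + _ + _); exact: ip2C. Qed.

Lemma normH_sqr phi : normH a l phi ^+ 2 = ipH a l phi phi.
Proof. by rewrite sqr_sqrtr// !addr_ge0 ?ip2_ge0. Qed.

Lemma ip2_0r (L : R) (f g : R -> R) : (forall x, 0 < x < L -> g x = 0) -> ip2 L f g = 0.
Proof.
move=> g0; rewrite /ip2 (@eq_Rintegral _ _ _ (@lebesgue_measure R) _ (fun=> 0)).
  by rewrite /Rintegral integral0.
by move=> x /set_mem/=; rewrite in_itv/= => /g0 ->; rewrite mulr0.
Qed.

Lemma derive_cst0 (L x : R) : 0 < L -> 0 <= x <= L ->
  derivableI L (fun _ => 0 : R) x /\ dI L (fun _ => 0 : R) x = 0.
Proof.
by move=> L0 xL; apply: approxI_dI => //; apply: is_derive_approxI; exact: is_derive_cst.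
Qed.

Lemma H1_0 (L : R) : 0 < L -> H1 L (fun _ => 0 : R).
Proof.
move=> L0; split.
- by apply: (@abs_cont_lipschitz _ _ 0) => *; rewrite subrr normr0 mul0r.
- apply: aeW => x; rewrite in_itv/= => /andP[x0 xL].
  by have [] := @derive_cst0 L x L0; rewrite ?ltW.
- apply: L2_eq (L2_cst L 0) => x /andP[x0 xL].
  by have [] := @derive_cst0 L x L0; rewrite ?ltW.
Qed.

Lemma norm2_dI0 (L : R) : 0 < L -> norm2 L (dI L (fun _ => 0)) = 0.
Proof.
move=> L0; rewrite /norm2 ip2_0r ?sqrtr0// => x /andP[x0 xL].
by have [] := @derive_cst0 L x L0; rewrite ?ltW.
Qed.

Lemma ring_part0 : ring_part a (fun _ _ => 0 : R) = fun _ => 0.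
Proof. by apply/funext => x; rewrite /ring_part; case: ifP. Qed.

Hypotheses (a0 : 0 < a) (l0 : 0 < l).

Lemma inH10_0 : inH10 a l (fun _ _ => 0 : R).
Proof.
have a20 : 0 < a *+ 2 by rewrite mulrn_wgt0.
by rewrite /inH10 /inH1 ring_part0; split => //; split; exact: H1_0.
Qed.

Lemma normH1_0 : normH1 a l (fun _ _ => 0 : R) = 0.
Proof.
have a20 : 0 < a *+ 2 by rewrite mulrn_wgt0.
rewrite /normH1 ring_part0 !norm2_dI0// normH_sqr /ipH !ip2_0r//.
by rewrite !expr0n/= !addr0 sqrtr0.
Qed.

End GraphInnerProduct.

Theorem mainTheorem7 (R : realType) (a l : R) (a0 : 0 < a) (l0 : 0 < l)
    (q : gfun) (qcont : gcontinuous a l q) (T : R) (T0 : 0 < T) :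
  ~ exists C : R, forall phi1 phi2 : gfun,
      inH10 a l phi1 -> inH a l phi2 ->
      exists f1 : R -> R, L2 T f1 /\
        exists u : R -> gfun,
          [/\ solution a l q T f1 (fun _ => 0) u,
              eqH a l (u T) phi1,
              velocity_at a l q T u phi2 &
              norm2 T f1 <= C * (normH1 a l phi1 + normH a l phi2)].
Proof.
move=> [C ctrl]; have qc : forall e, {within `[0, len a l e], continuous (q e)}.
  by have [] := qcont.
have [K [c [K0 c0 lower]]] := mode_lower a0 l0 qc.
(* With |k - k'| <= 2 e, [velocity_gap] and the control cost combine to the factor e * r; |C| + 1
   replaces C, whose sign is unknown. *)
pose r := 2 * T * (T + 1) * (`|C| + 1).
have r0 : 0 < r by rewrite !mulr_gt0//; have := normr_ge0 C; lra.
(* Chosen so that s^2 < c: the target will have norm at most s, yet squared norm at least c. *)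
pose s := Num.min 1 (c / 2).
have s0 : 0 < s by rewrite lt_min ltr01 divr_gt0.
have ss : s ^+ 2 < c.
  have s1 : s <= 1 by rewrite ge_min lexx.
  have sc : s <= c / 2 by rewrite ge_min lexx orbT.
  have : s * s <= s * 1 by rewrite ler_wpM2l// ltW.
  by rewrite expr2; lra.
pose e := Num.min (s / r) (Num.min (8 * a)^-1 (8 * l)^-1).
have e0 : 0 < e by rewrite !lt_min divr_gt0// !invr_gt0 !mulr_gt0.
have er : e * r <= s by rewrite -ler_pdivlMr// ge_min lexx.
have ea : 8 * (a * e) <= 1.
  by rewrite mulrA mulrC -ler_pdivlMr ?mulr_gt0// mul1r !ge_min lexx orbT.
have el : 8 * (l * e) <= 1.
  by rewrite mulrA mulrC -ler_pdivlMr ?mulr_gt0// mul1r !ge_min lexx !orbT.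
have modeL k A B : modefun a l k A B e1 l = A e1 0.
  by rewrite /modefun/= subrr oscy0.
have [[k [A [B [Kk mo A1 AB0]]]]|] := modes_exist a0 l0 qc K e0 ea el.
  have k0 : k != 0 by rewrite gt_eqF//; lra.
  have em := mode_eigenmode a0 l0 qc k0 mo.
  set phi := modefun a l k A B in em.
  have Hphi : inH a l phi by have [] := em.
  have [f [fL2 [u [sol _ vel _]]]] := ctrl _ _ (inH10_0 a0 l0) Hphi.
  (* Compared with the zero mode at the same k, [velocity_gap] makes the target [phi] orthogonal to
     itself. *)
  have mo0 : mode a l q k (fun _ _ => 0) (fun _ _ => 0).
    have y0 x : oscy k (fun _ => 0) (fun _ => 0) x = 0 :> R by rewrite /oscy !mul0r addr0.
    have w0 x : oscw k (fun _ => 0) (fun _ => 0) x = 0 :> R by rewrite /oscw oppr0 !mul0r addr0.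
    split; rewrite ?y0 ?w0 ?addr0//.
    by move=> i x _; rewrite y0 !mulr0 !mul0r oppr0; split; exact: is_derive_cst.
  have em0 := mode_eigenmode a0 l0 qc k0 mo0.
  have := velocity_gap T0 em em0 _ fL2 sol vel; rewrite /phi !modeL A1 => /(_ erefl).
  rewrite normr0 !mul0r normr_le0 subr_eq0 => /eqP ip0.
  have := lower k A B Kk mo; rewrite -/phi ip0 [X in _ <= X](_ : _ = 0).
    rewrite A1 expr0n/= add0r pmulr_rle0// => AB.
    have : A e2 0 ^+ 2 + B e2 0 ^+ 2 == 0 by rewrite eq_le AB addr_ge0 ?sqr_ge0.
    rewrite paddr_eq0 ?sqr_ge0// !sqrf_eq0 => /andP[/eqP A2 /eqP B2].
    by apply: AB0; rewrite A2 B2.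
  by rewrite /ipH !ip2_0r ?addr0// => x _; rewrite /modefun /oscy !mul0r addr0.
move=> [k [k' [A [B [A' [B' [Kk Kk' kk ke [mo mo' A1 A1']]]]]]]].
have k0 : 0 < k by lra.
have k'0 : 0 < k' by lra.
have kn0 : k != 0 by rewrite gt_eqF.
have k'n0 : k' != 0 by rewrite gt_eqF.
have em := mode_eigenmode a0 l0 qc kn0 mo.
have em' := mode_eigenmode a0 l0 qc k'n0 mo'.
have orth := mode_orthogonal a0 l0 k0 k'0 kk mo mo'.
have low := lower k A B Kk mo; have low' := lower k' A' B' Kk' mo'.
have phil : modefun a l k A B e1 l = 1 by rewrite modeL.
have phil' : modefun a l k' A' B' e1 l = 1 by rewrite modeL.
have {}low : c <= ipH a l (modefun a l k A B) (modefun a l k A B).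
  apply: le_trans low; rewrite A1 expr1n ler_peMr ?(ltW c0)//.
  by rewrite lerDl addr_ge0 ?sqr_ge0.
have {}low' : 0 <= ipH a l (modefun a l k' A' B') (modefun a l k' A' B').
  by apply: le_trans low'; rewrite mulr_ge0 ?(ltW c0)// !addr_ge0 ?sqr_ge0.
move: em em' orth low low' phil phil'.
set phi := modefun a l k A B; set phi' := modefun a l k' A' B' => em em' orth low low' phil phil'.
have Hphi : inH a l phi by have [] := em.
have Hphi' : inH a l phi' by have [] := em'.
pose g := gsub phi phi'.
have Hg : inH a l g by exact: inH_gsub.
(* With target velocity g the gap of the two moments is exactly the squared norm of g. *)
have gg : normH a l g ^+ 2 = ipH a l g phi - ipH a l g phi'.
  by rewrite normH_sqr -ipHBr.
have ggE : normH a l g ^+ 2 = ipH a l phi phi + ipH a l phi' phi'.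
  rewrite gg ![ipH a l g _]ipHC !ipHBr// orth [ipH a l phi' phi]ipHC orth; ring.
have [f [fL2 [u [sol _ vel fC]]]] := ctrl _ _ (inH10_0 a0 l0) Hg.
have := velocity_gap T0 em em' (etrans phil (esym phil')) fL2 sol vel.
rewrite phil normr1 mul1r -gg ger0_norm ?sqr_ge0// => gap.
rewrite normH1_0// add0r in fC.
have N0 : 0 <= normH a l g by exact: sqrtr_ge0.
have fC' : norm2 T f <= (`|C| + 1) * normH a l g.
  apply: (le_trans fC); rewrite ler_wpM2r//.
  by have := ler_norm C; lra.
have gN : normH a l g ^+ 2 <= s * normH a l g.
  apply: (le_trans gap).
  apply: (@le_trans _ _ (2 * e * T * ((T + 1) * ((`|C| + 1) * normH a l g)))).
    apply: ler_pM => //.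
    - by rewrite mulr_ge0// ltW.
    - by rewrite mulr_ge0 ?sqrtr_ge0//; lra.
    - by rewrite ler_wpM2r// ltW.
    - by rewrite ler_wpM2l//; lra.
  have -> : 2 * e * T * ((T + 1) * ((`|C| + 1) * normH a l g)) = e * r * normH a l g.
    by rewrite /r; ring.
  by rewrite ler_wpM2r.
have Npos : 0 < normH a l g.
  rewrite lt_neqAle N0 andbT eq_sym; apply/eqP => g0.
  by move: ggE; rewrite g0 expr0n/=; lra.
have : normH a l g <= s by rewrite -(ler_pM2r Npos) -expr2.
move=> Ns; have : normH a l g ^+ 2 <= s ^+ 2 by rewrite ler_sqr ?nnegrE// ltW.
by rewrite ggE; lra.
Qed.
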